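(* Let $\mathfrak{L}\in\{\mathfrak{b}_3,\mathfrak{d}_4\}$ with its $\mathbb{Z}_2^3$-grading $\Gamma_{\mathfrak{L}}$. Then representatives of all the equivalence classes (with respect to $\sim$) of graded contractions of $\Gamma_{\mathfrak{L}}$ are just the following: (i) $\{\varepsilon^{T_i} \mid 1\le i\le 24,\ i\neq 8,14,17,20\}$ (one class for each such $i$); (ii) $\{(1,1,1,\lambda)\mid \lambda\in\mathbb{C}^\times\}$ related to $T_{14}$, where $(1,1,1,\lambda)\sim(1,1,1,\lambda')$ if and only if $\lambda'\in\{\lambda,\frac{1}{\lambda}\}$; (iii) $\{(1,\lambda,1,1,\lambda)\mid \lambda\in\mathbb{C}^\times\}$ related to $T_{17}$, where $(1,\lambda,1,1,\lambda)\sim(1,\lambda',1,1,\lambda')$ if and only if $\lambda'\in\{\pm\lambda,\pm\frac{1}{\lambda}\}$; (iv) $\{(1,\lambda,\mu,1,\lambda,\mu)\mid \lambda,\mu\in\mathbb{C}^\times\}$ related to $T_{20}$, where $(1,\lambda,\mu,1,\lambda,\mu)\sim(1,\lambda',\mu',1,\lambda',\mu')$ if and only if the set $\{\pm\lambda',\pm\mu'\}$ coincides with either $\{\pm\lambda,\pm\mu\}$ or $\{\pm\frac{1}{\lambda},\pm\frac{\mu}{\lambda}\}$ or $\{\pm\frac{\lambda}{\mu},\pm\frac{1}{\mu}\}$. That is, every graded contraction of $\Gamma_{\mathfrak{L}}$ is equivalent to one of those listed, and two listed ones are equivalent only in the cases described in (ii), (iii), (iv).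
   Context: **Octonions and gradings.** $I=\{1,\dots,7\}$; the lines of the Fano plane are $\mathbf{L}=\{(1,2,5),(5,6,7),(7,4,1),(1,3,6),(6,4,2),(2,7,3),(3,4,5)\}$. For $i\ne j$ in $I$, $i*j\in I$ is the third point on the line through $i,j$, and $\ell_{ij}=\{i,j,i*j\}$. $\mathcal{O}$ is the complex octonion algebra with basis $e_0=1,e_1,\dots,e_7$, $e_i^2=-1$ for $i\neq 0$, and $e_ie_j=-e_je_i=e_k$ whenever $(i,j,k)$ is a cyclic permutation of an element of $\mathbf{L}$. $n$ is the symmetric bilinear form with $n(e_i,e_j)=\delta_{ij}$. $\mathfrak{d}_4=\mathfrak{so}(\mathcal{O},n)=\{f\in\mathfrak{gl}(\mathcal{O}): n(f(x),y)+n(x,f(y))=0\ \forall x,y\}$ and $\mathfrak{b}_3=\{f\in\mathfrak{d}_4: f(1)=0\}$. Let $G=\mathbb{Z}_2^3$ with neutral element $e$, and $g_0=(0,0,0)$, $g_1=(1,0,0)$, $g_2=(0,1,0)$, $g_3=(0,0,1)$, $g_4=(1,1,1)$, $g_5=(1,1,0)$, $g_6=(1,0,1)$, $g_7=(0,1,1)$ (so $g_i+g_j=g_{i*j}$ for $i\ne j\in I$). $\mathcal{O}$ is $G$-graded by $\mathcal{O}_{g_i}=\mathbb{C}e_i$. For $\mathfrak{L}\in\{\mathfrak{b}_3,\mathfrak{d}_4\}$, $\Gamma_{\mathfrak{L}}$ is the $G$-grading $\mathfrak{L}=\bigoplus_{g\in G}\mathfrak{L}_g$ with $\mathfrak{L}_g=\{f\in\mathfrak{L}: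 f(\mathcal{O}_h)\subseteq\mathcal{O}_{g+h}\ \forall h\in G\}$. **Graded contractions.** For a $G$-grading $\Gamma$ on a complex Lie algebra $\mathfrak{L}$, a graded contraction of $\Gamma$ is a map $\varepsilon\colon G\times G\to\mathbb{C}$ such that the vector space $\mathfrak{L}$ with product $[x,y]^\varepsilon:=\varepsilon(g,h)[x,y]$ ($x\in\mathfrak{L}_g$, $y\in\mathfrak{L}_h$) is a Lie algebra, denoted $\mathfrak{L}^\varepsilon$ (it is $G$-graded with the same components). Two graded contractions are equivalent, $\varepsilon\sim\varepsilon'$, if there is a Lie algebra isomorphism $f\colon\mathfrak{L}^\varepsilon\to\mathfrak{L}^{\varepsilon'}$ such that for each $g\in G$ there is $h\in G$ with $f(\mathfrak{L}_g)=\mathfrak{L}_h$. $\varepsilon$ is admissible if $\varepsilon(g,g)=\varepsilon(e,g)=\varepsilon(g,e)=0$ for all $g$. Let $X=\{\{i,j\}:1\le i<j\le 7\}$. For the gradings considered here an admissible graded contraction is symmetric, hence is determined by the map $X\to\mathbb{C}$, $\{i,j\}\mapsto\varepsilon_{ij}:=\varepsilon(g_i,g_j)$, and its support is $\{\{i,j\}\in X:\varepsilon_{ij}\ne0\}$. **The sets $T_i$** (subsets of $X$). For $T\subseteq X$, $\varepsilon^T$ is the admissible map with $\varepsilon^T_{ij}=1$ if $\{i,j\}\in T$ and $0$ otherwise. Writing $ij$ for $\{i,j\}$: $T_1=\emptyset$; $T_2=\{12\}$; $T_3=\{12,13\}$; $T_4=\{12,15\}$; $T_5=\{12,67\}$;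 $T_6=\{12,15,25\}$; $T_7=\{25,36,47\}$; $T_8=\{12,13,14\}$; $T_9=\{12,13,15\}$; $T_{10}=\{12,13,17\}$; $T_{11}=\{12,16,26\}$; $T_{12}=\{12,16,67\}$; $T_{13}=\{12,13,14,15\}$; $T_{14}=\{12,13,15,16\}$; $T_{15}=\{12,16,17,26\}$; $T_{16}=\{12,16,27,67\}$; $T_{17}=\{12,13,14,15,16\}$; $T_{18}=\{12,16,17,26,27\}$; $T_{19}=\{34,36,37,46,47,67\}$; $T_{20}=\{12,13,14,15,16,17\}$; $T_{21}=\{12,13,17,23,26,35\}$; $T_{22}=T_{21}\cup\{14,15,16,56\}$; $T_{23}=X\setminus T_{19}$; $T_{24}=X$. A tuple ''related to $T_i$'' denotes the admissible graded contraction with support $T_i$ whose values on the edges of $T_i$, in the order in which they are listed above, are the entries of the tuple: $(1,1,1,\lambda)$ means $\varepsilon_{12}=\varepsilon_{13}=\varepsilon_{15}=1,\varepsilon_{16}=\lambda$; $(1,\lambda,1,1,\lambda)$ means $\varepsilon_{12}=\varepsilon_{14}=\varepsilon_{15}=1$, $\varepsilon_{13}=\varepsilon_{16}=\lambda$; $(1,\lambda,\mu,1,\lambda,\mu)$ means $\varepsilon_{12}=\varepsilon_{15}=1$, $\varepsilon_{13}=\varepsilon_{16}=\lambda$, $\varepsilon_{14}=\varepsilon_{17}=\mu$. *)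

(* Defs.v *)
From HB Require Import structures.
From mathcomp Require Import all_boot all_order all_algebra.
From mathcomp Require Import boolp classical_sets.
From mathcomp Require Import reals complex.

Set Implicit Arguments.
Unset Strict Implicit.
Unset Printing Implicit Defensive.

Import GRing.Theory.
Local Open Scope ring_scope.

(* The subspace {v | P v} for a linearly closed P; junk when P is not linearly
   closed (see memv_vspace_of). *)
Definition vspace_of (F : fieldType) (V : vectType F) (P : V -> Prop) :
    {vspace V} :=
  xget 0%VS [set U : {vspace V} | forall v, v \in U <-> P v]%classic.

Lemma memv_vspace_of (F : fieldType) (V : vectType F) (P : V -> Prop) :
  P 0 -> (forall a x y, P x -> P y -> P (a *: x + y)) ->
  forall v, v \in vspace_of P <-> P v.
Proof.
move=> P0 Plin.
pose Q (d : nat) := `[< exists2 U : {vspace V}, \dim U = d & forall v, v \in U -> P v >].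
have exQ : exists d, Q d.
  exists 0%N; apply/asboolP; exists 0%VS; first by rewrite dimv0.
  by move=> v; rewrite memv0 => /eqP->.
have ubQ d : Q d -> (d <= \dim {:V})%N.
  by move=> /asboolP[U <- _]; apply: dimvS (subvf U).
case: (ex_maxnP exQ ubQ) => d /asboolP[U dU UP] maxU.
suff exU : exists W : {vspace V}, forall v, v \in W <-> P v.
  exact: (@xgetPex _ 0%VS
            [set W : {vspace V} | forall v, v \in W <-> P v]%classic exU).
exists U => v; split=> [|Pv]; first exact: UP.
have UvP w : w \in (<[v]> + U)%VS -> P w.
  by case/memv_addP=> _ /vlineP[a ->] [u Uu ->]; apply: Plin => //; apply: UP.
have /maxU : Q (\dim (<[v]> + U)%VS) by apply/asboolP; exists (<[v]> + U)%VS.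
rewrite -dU => le_dim.
have -> : U = (<[v]> + U)%VS.
  by apply/eqP; rewrite eqEdim addvSr le_dim.
by apply: subvP (addvSl _ _) _ (memv_line v).
Qed.

Section GradedContractions.
Variables (F : fieldType) (G : finZmodType) (V : vectType F).
Variables (br : V -> V -> V) (Gam : G -> {vspace V}).

Definition lie_law (m : V -> V -> V) : Prop :=
  [/\ forall x, linear (m x),
      forall y, linear (m^~ y),
      forall x, m x x = 0 &
      forall x y z, m x (m y z) + m y (m z x) + m z (m x y) = 0].

Definition is_grading : Prop :=
  [/\ (\sum_g Gam g)%VS = fullv,
      directv (\sum_g Gam g)%VS &
      forall g h x y, x \in Gam g -> y \in Gam h -> br x y \in Gam (g + h)].

Definition hcomp (g : G) : 'End(V) := sumv_pi (\sum_k Gam k)%VS g.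

(* The bilinear product with (x, y) |-> eps g h *: br x y on Gam g x Gam h,
   see contractE. *)
Definition contract (eps : G -> G -> F) (x y : V) : V :=
  \sum_g \sum_h eps g h *: br (hcomp g x) (hcomp h y).

Definition graded_contraction (eps : G -> G -> F) : Prop :=
  lie_law (contract eps).

Definition contraction_equiv (eps eps' : G -> G -> F) : Prop :=
  exists f : 'End(V),
    [/\ bijective f,
        forall x y, f (contract eps x y) = contract eps' (f x) (f y) &
        forall g, exists h, (f @: Gam g)%VS = Gam h].

Lemma hcompE : is_grading -> forall g k x,
  x \in Gam g -> hcomp k x = if k == g then x else 0.
Proof.
case=> _ dxG _ g k x Gx.
pose u k := if k == g then x else 0.
have sx : \sum_k u k = x by rewrite /u -big_mkcond big_pred1_eq.
have Su k' : true -> u k' \in Gam k'.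
  by move=> _; rewrite /u; case: eqP => [->|] //; rewrite mem0v.
have Vx : x \in (\sum_k Gam k)%VS by rewrite -sx; apply: memv_sumr.
have Hx : \sum_k' hcomp k' x = \sum_k' u k'.
  by rewrite sx /hcomp; apply: sumv_pi_sum.
have := directv_sum_unique dxG (fun k' => hcomp k' x) u.
rewrite Hx eqxx => /(_ (fun k' _ => memv_sum_pi _ _ _) Su) /esym /forall_inP.
by move=> /(_ k isT) /eqP.
Qed.

Lemma contractE : is_grading -> (forall x, br 0 x = 0) -> (forall x, br x 0 = 0) ->
  forall eps g h x y, x \in Gam g -> y \in Gam h ->
  contract eps x y = eps g h *: br x y.
Proof.
move=> grG br0x brx0 eps g h x y Gx Hy; rewrite /contract (bigD1 g) //=.
rewrite [X in _ + X]big1 => [|k /negPf nk]; last first.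
  by apply: big1 => l _; rewrite (hcompE grG _ Gx) nk br0x scaler0.
rewrite addr0 (bigD1 h) //= big1 => [|l /negPf nl]; last first.
  by rewrite (hcompE grG l Hy) nl brx0 scaler0.
by rewrite addr0 (hcompE grG _ Gx) (hcompE grG _ Hy) !eqxx.
Qed.

End GradedContractions.

Definition Z23 : Type := ('Z_2 * 'Z_2 * 'Z_2)%type.

HB.instance Definition _ := Finite.on Z23.
HB.instance Definition _ := GRing.Zmodule.on Z23.

Definition gdeg : 8.-tuple Z23 :=
  [tuple (0, 0, 0); (1, 0, 0); (0, 1, 0); (0, 0, 1);
         (1, 1, 1); (1, 1, 0); (1, 0, 1); (0, 1, 1)].

Lemma tnth_gdeg_inj : injective (tnth gdeg).
Proof. by apply/tuple_uniqP. Qed.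

Lemma gdeg_surj g : exists i, tnth gdeg i = g.
Proof.
have /codomP[i ->] : g \in codom (tnth gdeg); last by exists i.
by apply: inj_card_onto; [apply: tnth_gdeg_inj | rewrite !card_prod !card_ord].
Qed.

(* Cyclic permutations of the lines: fano i j k means e_i e_j = e_k. *)
Definition fano_lines : seq (nat * nat * nat) :=
  [:: (1, 2, 5); (5, 6, 7); (7, 4, 1); (1, 3, 6);
      (6, 4, 2); (2, 7, 3); (3, 4, 5)]%N.

Definition fano (i j k : nat) : bool :=
  [|| (i, j, k) \in fano_lines, (j, k, i) \in fano_lines
    | (k, i, j) \in fano_lines].

Section Octonions.
Variable F : fieldType.

Definition oct := 'rV[F]_8.

Definition oct_e (i : 'I_8) : oct := delta_mx 0 i.

Definition oct_1 : oct := oct_e 0.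

Definition oct_mul_e (i j : 'I_8) : oct :=
  if i == 0 then oct_e j
  else if j == 0 then oct_e i
  else if i == j then - oct_1
  else \sum_(k < 8) ((fano i j k)%:R - (fano j i k)%:R) *: oct_e k.

Definition oct_mul (x y : oct) : oct :=
  \sum_i \sum_j (x 0 i * y 0 j) *: oct_mul_e i j.

Definition oct_n (x y : oct) : F := \sum_i x 0 i * y 0 i.

Definition oct_deg (g : Z23) : {vspace oct} :=
  (\sum_(i | tnth gdeg i == g) <[oct_e i]>)%VS.

Definition gl_bracket (f g : 'End(oct)) : 'End(oct) := (f \o g)%VF - (g \o f)%VF.

Lemma oct_eE i j : oct_e i 0 j = (j == i)%:R.
Proof. by rewrite mxE eqxx. Qed.

Lemma oct_sum (x : oct) : x = \sum_i x 0 i *: oct_e i.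
Proof. exact: row_sum_delta. Qed.

Lemma oct_mul1 (x : oct) : oct_mul oct_1 x = x.
Proof.
rewrite /oct_mul (bigD1 0) //= [X in _ + X]big1 ?addr0 => [|i /negPf ni]; last first.
  by rewrite big1 // => j _; rewrite oct_eE ni mul0r scale0r.
rewrite [RHS]oct_sum; apply: eq_bigr => j _.
by rewrite oct_eE eqxx mul1r /oct_mul_e eqxx.
Qed.

Lemma mem_oct_deg g (x : oct) :
  x \in oct_deg g <-> forall i, tnth gdeg i != g -> x 0 i = 0.
Proof.
split=> [/memv_sumP[u uG ->] i ni|x0].
  rewrite summxE big1 // => j gj; have /vlineP[a ->] := uG j gj.
  rewrite mxE oct_eE; have [E|_] := eqVneq i j; last by rewrite mulr0.
  by rewrite E gj in ni.
rewrite (oct_sum x); apply: memv_suml => i _.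
case: (eqVneq (tnth gdeg i) g) => [gi|/x0->]; last by rewrite scale0r mem0v.
apply: subvP (memvZ _ (memv_line _)).
by apply: (sumv_sup i) => //; rewrite gi.
Qed.

Lemma fano_gdeg (i j k : 'I_8) :
  fano i j k -> tnth gdeg k = tnth gdeg i + tnth gdeg j.
Proof.
rewrite !(tnth_nth 0); move: (i : nat) (j : nat) (k : nat) => {}i {}j {}k.
rewrite /fano !inE -!orbA => ijk.
by repeat case/orP: ijk => ijk; case/eqP: ijk => -> -> ->; apply/eqP.
Qed.

Lemma Z23_addgg (g : Z23) : g + g = 0.
Proof.
case: g => [[a b] c]; have H (x : 'Z_2) : x + x = 0.
  by apply/val_inj; case: x => [[|[|]]].
by rewrite -[LHS]/(a + a, b + b, c + c) !H.
Qed.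

(* The product is G-graded. *)
Lemma oct_mul_deg g h x y :
  x \in oct_deg g -> y \in oct_deg h -> oct_mul x y \in oct_deg (g + h).
Proof.
move=> /mem_oct_deg xg /mem_oct_deg yh; apply: memv_suml => i _.
apply: memv_suml => j _.
case: (eqVneq (tnth gdeg i) g) => [<-|/xg->]; last by rewrite mul0r scale0r mem0v.
case: (eqVneq (tnth gdeg j) h) => [<-|/yh->]; last by rewrite mulr0 scale0r mem0v.
apply: memvZ; apply/mem_oct_deg => k.
have g0 : tnth gdeg 0 = 0 by [].
rewrite /oct_mul_e; case: (eqVneq i 0) => [->|i0].
  by rewrite g0 add0r oct_eE; case: (eqVneq k j) => [->|] //; rewrite eqxx.
case: (eqVneq j 0) => [->|j0].
  by rewrite g0 addr0 oct_eE; case: (eqVneq k i) => [->|] //; rewrite eqxx.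
case: (eqVneq i j) => [->|_].
  rewrite Z23_addgg mxE oct_eE; case: (eqVneq k 0) => [->|]; last by rewrite oppr0.
  by rewrite g0 eqxx.
move=> nk; rewrite summxE (bigD1 k) //= big1 => [|l /negPf nl]; last first.
  by rewrite mxE oct_eE eq_sym nl mulr0.
rewrite mxE addr0; have [/fano_gdeg E|_] := boolP (fano i j k).
  by rewrite E eqxx in nk.
have [/fano_gdeg E|_] := boolP (fano j i k); last by rewrite subrr mul0r.
by rewrite E addrC eqxx in nk.
Qed.

(* so(O, n) *)
Definition d4 : {vspace 'End(oct)} :=
  vspace_of (fun f : 'End(oct) => forall x y, oct_n (f x) y + oct_n x (f y) = 0).

Definition b3 : {vspace 'End(oct)} :=
  vspace_of (fun f : 'End(oct) => f \in d4 /\ f oct_1 = 0).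

Lemma oct_nC x y : oct_n x y = oct_n y x.
Proof. by apply: eq_bigr => i _; rewrite mulrC. Qed.

Lemma oct_n_linear x : linear (oct_n x : oct -> F^o).
Proof.
move=> a y z; rewrite /oct_n scaler_sumr -big_split /=.
by apply: eq_bigr => i _; rewrite !mxE mulrDr mulrCA.
Qed.

Lemma oct_nDl a x y z : oct_n (a *: x + y) z = a * oct_n x z + oct_n y z.
Proof. by rewrite oct_nC oct_n_linear !(oct_nC z). Qed.

Lemma oct_nDr a x y z : oct_n z (a *: x + y) = a * oct_n z x + oct_n z y.
Proof. exact: oct_n_linear. Qed.

Lemma memv_d4 (f : 'End(oct)) :
  f \in d4 <-> forall x y, oct_n (f x) y + oct_n x (f y) = 0.
Proof.
apply: memv_vspace_of => [x y|a f1 f2 H1 H2 x y].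
  by rewrite !lfunE /= /oct_n -big_split big1 // => i _ /=; rewrite !mxE mul0r mulr0 addr0.
rewrite !add_lfunE !scale_lfunE oct_nDl oct_nDr addrACA -mulrDr.
by rewrite H1 H2 mulr0 addr0.
Qed.

Lemma memv_b3 (f : 'End(oct)) : f \in b3 <-> f \in d4 /\ f oct_1 = 0.
Proof.
apply: memv_vspace_of => [|a f1 f2 [D1 E1] [D2 E2]].
  by rewrite mem0v zero_lfunE.
by rewrite rpredD ?rpredZ // add_lfunE scale_lfunE E1 E2 scaler0 addr0.
Qed.

Lemma gl_bracketE (f g : 'End(oct)) x : gl_bracket f g x = f (g x) - g (f x).
Proof. by rewrite /gl_bracket add_lfunE opp_lfunE !comp_lfunE. Qed.

Lemma d4_bracket (f g : 'End(oct)) : f \in d4 -> g \in d4 -> gl_bracket f g \in d4.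
Proof.
move=> /memv_d4 Hf /memv_d4 Hg; apply/memv_d4 => x y.
have Ef u v : oct_n (f u) v = - oct_n u (f v) by apply/eqP; rewrite -addr_eq0 Hf.
have Eg u v : oct_n (g u) v = - oct_n u (g v) by apply/eqP; rewrite -addr_eq0 Hg.
have nBl u v w : oct_n (u - v) w = oct_n u w - oct_n v w.
  by rewrite addrC -scaleN1r oct_nDl mulN1r addrC.
have nBr u v w : oct_n w (u - v) = oct_n w u - oct_n w v.
  by rewrite addrC -scaleN1r oct_nDr mulN1r addrC.
rewrite !gl_bracketE nBl nBr (Ef (g x)) (Eg x) (Eg (f x)) (Ef x) !opprK.
by rewrite subrKA subrr.
Qed.

Lemma b3_bracket (f g : 'End(oct)) :
  f \in b3 -> g \in b3 -> gl_bracket f g \in b3.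
Proof.
move=> /memv_b3[Df f1] /memv_b3[Dg g1]; apply/memv_b3; split.
  exact: d4_bracket.
by rewrite gl_bracketE f1 g1 (linear0 f) (linear0 g) addrN.
Qed.

Section SubLie.
Variable L : {vspace 'End(oct)}.

(* vsproj L only retypes the commutator, which lies in L when L is b3 or d4
   (see vsval_bracket). *)
Definition bracket (x y : subvs_of L) : subvs_of L :=
  vsproj L (gl_bracket (vsval x) (vsval y)).

Definition Gamma (g : Z23) : {vspace subvs_of L} :=
  vspace_of (fun f : subvs_of L =>
    forall h, (vsval f @: oct_deg h <= oct_deg (g + h)%R)%VS).

Lemma memv_Gamma g (f : subvs_of L) :
  f \in Gamma g <-> forall h, (vsval f @: oct_deg h <= oct_deg (g + h)%R)%VS.
Proof.
apply: memv_vspace_of => [h|a f1 f2 H1 H2 h].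
  by apply/subvP => _ /memv_imgP[x _ ->]; rewrite linear0 zero_lfunE mem0v.
apply/subvP => _ /memv_imgP[x hx ->].
rewrite linearP add_lfunE scale_lfunE.
apply: memvD; [apply: memvZ; apply: subvP (H1 h) _ _|apply: subvP (H2 h) _ _];
  exact: memv_img.
Qed.

End SubLie.

Lemma vsval_bracket L : L = b3 \/ L = d4 ->
  forall x y : subvs_of L, vsval (bracket x y) = gl_bracket (vsval x) (vsval y).
Proof.
move=> HL x y; apply: vsprojK; have := subvsP y; have := subvsP x.
by case: HL x y => -> x y; [apply: b3_bracket | apply: d4_bracket].
Qed.

Lemma mem_oct_e i : oct_e i \in oct_deg (tnth gdeg i).
Proof. by apply: subvP (memv_line _); apply: (sumv_sup i). Qed.

Lemma Gamma_entry L g (f : subvs_of L) :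
  f \in Gamma L g <->
  forall i j, tnth gdeg j != g + tnth gdeg i -> vsval f (oct_e i) 0 j = 0.
Proof.
split=> [/memv_Gamma fg i j|f0].
  have : vsval f (oct_e i) \in oct_deg (g + tnth gdeg i).
    by apply: subvP (fg _) _ _; apply: memv_img (mem_oct_e i).
  by move/mem_oct_deg; apply.
apply/memv_Gamma => h; apply/subvP => _ /memv_imgP[x /mem_oct_deg xh ->].
rewrite (oct_sum x) linear_sum; apply: memv_suml => i _ /=.
rewrite linearZ /=; case: (eqVneq (tnth gdeg i) h) => [<-|/xh->]; last first.
  by rewrite scale0r mem0v.
by apply: memvZ; apply/mem_oct_deg => j; apply: f0.
Qed.

Lemma end_entry (f f' : 'End(oct)) :
  (forall i j, f (oct_e i) 0 j = f' (oct_e i) 0 j) -> f = f'.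
Proof.
move=> H; apply/lfunP => x; rewrite (oct_sum x) !linear_sum.
apply: eq_bigr => i _; rewrite !linearZ; congr (_ *: _).
by apply/rowP => j; apply: H.
Qed.

Definition mx_end (a : 'I_8 -> 'I_8 -> F) : 'End(oct) :=
  linfun (mulmxr (\matrix_(i, j) a i j) : oct -> oct).

Lemma mx_endE a i j : mx_end a (oct_e i) 0 j = a i j.
Proof. by rewrite lfunE /= -rowE !mxE. Qed.

Lemma d4_entry (f : 'End(oct)) :
  f \in d4 <-> forall i j, f (oct_e i) 0 j + f (oct_e j) 0 i = 0.
Proof.
have nE u j : oct_n u (oct_e j) = u 0 j.
  rewrite /oct_n (bigD1 j) //= big1 => [|k /negPf nk].
    by rewrite oct_eE eqxx mulr1 addr0.
  by rewrite oct_eE nk mulr0.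
split=> [/memv_d4 H i j|H]; first by rewrite -!nE (oct_nC _ (oct_e i)) H.
apply/memv_d4 => x y.
have E (u v : oct) : oct_n (f u) v =
    \sum_i \sum_j u 0 i * v 0 j * f (oct_e i) 0 j.
  rewrite {1}(oct_sum u) linear_sum /oct_n exchange_big; apply: eq_bigr => j _.
  rewrite summxE mulr_suml; apply: eq_bigr => i _.
  by rewrite linearZ mxE mulrAC.
rewrite oct_nC (oct_nC x) oct_nC (E x y) (E y x) [X in _ + X]exchange_big.
rewrite -big_split big1 // => i _; rewrite -big_split big1 // => j _ /=.
by rewrite (mulrC (y 0 j)) -mulrDr H mulr0.
Qed.

Lemma b3_entry (f : 'End(oct)) :
  f \in b3 <-> f \in d4 /\ forall j, f (oct_e 0) 0 j = 0.
Proof.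
split=> [/memv_b3[Df f1]|[Df f1]].
  by split=> // j; rewrite -/oct_1 f1 mxE.
by apply/memv_b3; split=> //; apply/rowP => j; rewrite f1 mxE.
Qed.

Lemma mem_mask L g (f : 'End(oct)) : L = b3 \/ L = d4 -> f \in L ->
  mx_end (fun i j => if tnth gdeg j == g + tnth gdeg i
                     then f (oct_e i) 0 j else 0) \in L.
Proof.
set c := mx_end _ => HL.
have d4c : f \in d4 -> c \in d4.
  move=> /d4_entry H; apply/d4_entry => i j; rewrite !mx_endE.
  have -> : (tnth gdeg i == g + tnth gdeg j) = (tnth gdeg j == g + tnth gdeg i).
    by apply/eqP/eqP => ->; rewrite addrA Z23_addgg add0r.
  by case: eqP => _; rewrite ?H ?addr0.
case: HL => ->; last exact: d4c.
move=> /b3_entry[/d4c Dc f1]; apply/b3_entry; split=> // j.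
by rewrite mx_endE f1 if_same.
Qed.

Lemma Gamma_is_grading L : L = b3 \/ L = d4 ->
  is_grading (@bracket L) (Gamma L).
Proof.
move=> HL; split.
- apply/vspaceP => f; rewrite memvf.
  pose c g i j : F := if tnth gdeg j == g + tnth gdeg i
                      then vsval f (oct_e i) 0 j else 0.
  have cL g : mx_end (c g) \in L by apply: mem_mask (subvsP f).
  have -> : f = \sum_g vsproj L (mx_end (c g)).
    apply/val_inj; apply: end_entry => i j.
    rewrite /= linear_sum sum_lfunE summxE.
    rewrite (bigD1 (tnth gdeg j + tnth gdeg i)) //= big1 => [|g ng].
      rewrite addr0 vsprojK // mx_endE /c -addrA Z23_addgg addr0 eqxx //.
    rewrite vsprojK // mx_endE /c; case: eqP => // E; move: ng; rewrite E.
    by rewrite -addrA Z23_addgg addr0 eqxx.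
  apply: memv_sumr => g _; apply/Gamma_entry => i j /negPf nij.
  by rewrite vsprojK // mx_endE /c nij.
- apply/directv_sum_independent => u Gu u0 g _.
  apply/val_inj; apply: end_entry => i j; rewrite /= zero_lfunE mxE.
  have [E|] := eqVneq (tnth gdeg j) (g + tnth gdeg i); last first.
    by move: i j; apply/Gamma_entry; apply: Gu.
  have : vsval (\sum_k u k) (oct_e i) 0 j = 0.
    by rewrite u0 linear0 zero_lfunE mxE.
  rewrite linear_sum sum_lfunE summxE (bigD1 g) //= big1 ?addr0 // => k nk.
  have /Gamma_entry := Gu k isT; apply.
  by rewrite E (inj_eq (addIr _)) eq_sym.
- move=> g h x y /memv_Gamma xg /memv_Gamma yh; apply/memv_Gamma => k.
  apply/subvP => _ /memv_imgP[v kv ->]; rewrite (vsval_bracket HL) gl_bracketE.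
  apply: memvB.
    rewrite -addrA; apply: subvP (xg _) _ _; apply: memv_img.
    by apply: subvP (yh _) _ _; apply: memv_img.
  rewrite (addrC g) -addrA; apply: subvP (yh _) _ _; apply: memv_img.
  by apply: subvP (xg _) _ _; apply: memv_img.
Qed.

Lemma contract_Gamma L : L = b3 \/ L = d4 ->
  forall eps g h (x y : subvs_of L), x \in Gamma L g -> y \in Gamma L h ->
  vsval (contract (@bracket L) (Gamma L) eps x y)
    = eps g h *: gl_bracket (vsval x) (vsval y).
Proof.
move=> HL eps g h x y xg yh.
have b0 (z : subvs_of L) : bracket 0 z = 0 /\ bracket z 0 = 0.
  split; apply: (can_inj vsvalK); rewrite (vsval_bracket HL) linear0;
  by apply/lfunP => v; rewrite gl_bracketE !zero_lfunE linear0 addrN.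
rewrite (contractE (Gamma_is_grading HL) (fun z => (b0 z).1) (fun z => (b0 z).2)
           eps xg yh).
by rewrite linearZ /= vsval_bracket.
Qed.

End Octonions.

(* An edge {i, j} is the pair (i, j) with i < j; the order of the lists is the
   order in which the entries of a tuple related to T i are read. *)
Definition edges_X : seq (nat * nat) :=
  [seq (i, j) | i <- iota 1 7, j <- iota i.+1 (7 - i)].

Definition T19 : seq (nat * nat) :=
  [:: (3, 4); (3, 6); (3, 7); (4, 6); (4, 7); (6, 7)]%N.

Definition T21 : seq (nat * nat) :=
  [:: (1, 2); (1, 3); (1, 7); (2, 3); (2, 6); (3, 5)]%N.

Definition T (i : nat) : seq (nat * nat) :=
  match i with
  | 1 => [::]
  | 2 => [:: (1, 2)]
  | 3 => [:: (1, 2); (1, 3)]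
  | 4 => [:: (1, 2); (1, 5)]
  | 5 => [:: (1, 2); (6, 7)]
  | 6 => [:: (1, 2); (1, 5); (2, 5)]
  | 7 => [:: (2, 5); (3, 6); (4, 7)]
  | 8 => [:: (1, 2); (1, 3); (1, 4)]
  | 9 => [:: (1, 2); (1, 3); (1, 5)]
  | 10 => [:: (1, 2); (1, 3); (1, 7)]
  | 11 => [:: (1, 2); (1, 6); (2, 6)]
  | 12 => [:: (1, 2); (1, 6); (6, 7)]
  | 13 => [:: (1, 2); (1, 3); (1, 4); (1, 5)]
  | 14 => [:: (1, 2); (1, 3); (1, 5); (1, 6)]
  | 15 => [:: (1, 2); (1, 6); (1, 7); (2, 6)]
  | 16 => [:: (1, 2); (1, 6); (2, 7); (6, 7)]
  | 17 => [:: (1, 2); (1, 3); (1, 4); (1, 5); (1, 6)]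
  | 18 => [:: (1, 2); (1, 6); (1, 7); (2, 6); (2, 7)]
  | 19 => T19
  | 20 => [:: (1, 2); (1, 3); (1, 4); (1, 5); (1, 6); (1, 7)]
  | 21 => T21
  | 22 => T21 ++ [:: (1, 4); (1, 5); (1, 6); (5, 6)]
  | 23 => [seq e <- edges_X | e \notin T19]
  | 24 => edges_X
  | _ => [::]
  end%N.

Section Representatives.
Variable F : fieldType.

(* The admissible map whose value on the k-th edge of E is the k-th entry of v
   and which vanishes on all other pairs; (0, 0), (0, j), (i, i) are never
   edges. *)
Definition eps_of (E : seq (nat * nat)) (v : seq F) (g h : Z23) : F :=
  let i := index g gdeg in let j := index h gdeg in
  nth 0 v (index (minn i j, maxn i j) E).

Definition epsT (i : nat) : Z23 -> Z23 -> F := eps_of (T i) (nseq (size (T i)) 1).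

Inductive rep : Type :=
  | RepT of nat          (* eps^(T_i) *)
  | RepT14 of F          (* (1, 1, 1, a) related to T_14 *)
  | RepT17 of F          (* (1, a, 1, 1, a) related to T_17 *)
  | RepT20 of F & F.     (* (1, a, b, 1, a, b) related to T_20 *)

Definition rep_valid (r : rep) : Prop :=
  match r with
  | RepT i => (1 <= i <= 24)%N /\ i \notin [:: 8; 14; 17; 20]%N
  | RepT14 a => a != 0
  | RepT17 a => a != 0
  | RepT20 a b => a != 0 /\ b != 0
  end.

Definition rep_eps (r : rep) : Z23 -> Z23 -> F :=
  match r with
  | RepT i => epsT i
  | RepT14 a => eps_of (T 14) [:: 1; 1; 1; a]
  | RepT17 a => eps_of (T 17) [:: 1; a; 1; 1; a]
  | RepT20 a b => eps_of (T 20) [:: 1; a; b; 1; a; b]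
  end.

Definition rep_same (r r' : rep) : Prop :=
  match r, r' with
  | RepT i, RepT i' => i = i'
  | RepT14 a, RepT14 a' => a' \in [:: a; a^-1]
  | RepT17 a, RepT17 a' => a' \in [:: a; - a; a^-1; - a^-1]
  | RepT20 a b, RepT20 a' b' =>
      let pm x y := [:: x; - x; y; - y] in
      [\/ pm a' b' =i pm a b, pm a' b' =i pm a^-1 (b / a)
        | pm a' b' =i pm (a / b) b^-1]
  | _, _ => False
  end.

End Representatives.

(* Main.v *)
(* An element of degree g of b_3 or d_4 is a function xi on Z_2^3 such that
   xi (s + g) = - xi s (and xi 0 = 0 in the case of b_3), and
   [xi, eta] s = eta s * xi (s + h) - xi s * eta (s + g). Brackets of elementary
   matrices show that eps is a graded contraction iff it is symmetric and
   eps g (h + k) * eps h k is invariant under rotation of the independent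
   triples (g, h, k). The support of eps is then a set of edges closed under
   finitely many implications; up to the collineations, which lift to
   automorphisms permuting the basis of O, there are just 24 of them. On a given
   support the values are normalized by rescaling the components.
   An equivalence permutes the components compatibly with the sums over the
   support, which is enough to tell all T_i apart, except that T_8 and T_10 are
   identified by the bracket with a regular element of degree g_1. On T_14, T_17
   and T_20, the invariants are the ratios of the products
   eps_1i * eps_1(1*i): some x of degree g_1 satisfies (ad x)^2 = -1 on the
   components i and j, and any t of degree g_1 for which (ad t)^2 is scalar on
   two such components has the same scalar on both. *)

From HB Require Import structures.
Require Import Defs.
From mathcomp Require Import all_boot all_order all_algebra.
From mathcomp Require Import boolp reals complex ring.

Set Implicit Arguments.
Unset Strict Implicit.
Unset Printing Implicit Defensive.

Import GRing.Theory Num.Theory.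
Local Open Scope ring_scope.

(** * The gradings of b_3 and d_4 *)

(** An equivalence need not be an automorphism of the original algebra: on the components it is a
    family of linear bijections compatible only with the contracted brackets, and it may come
    neither from a collineation nor from a rescaling. Whatever separates two contractions must be
    read off from data surviving such a map: which pairs of components have a nonzero contracted
    bracket, in which component it lies, and when the square of an adjoint map is scalar. For the
    last one nothing is known about the image of a chosen x, so an existence statement for x has to
    be paired with a rigidity statement valid for every element of its degree. Both algebras can be
    treated at once because all test elements have zero coefficients at e_0, hence lie in b_3,
    whereas the statements about arbitrary elements use only skew-symmetry. Square roots enter
    through the lines: if {i, j} and {i, i*j} are both in the support, normalizing them to 1
    prescribes the square of the scale on component i. *)

Lemma Z23_addK (g h : Z23) : g + h + h = g.
Proof. by rewrite -addrA Z23_addgg addr0. Qed.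

Lemma Z23_addKl (g h : Z23) : g + (g + h) = h.
Proof. by rewrite addrA Z23_addgg add0r. Qed.

Lemma Z23_add_eq0 (g h : Z23) : (g + h == 0) = (g == h).
Proof.
by apply/eqP/eqP => [E|->]; [rewrite -(Z23_addK g h) E add0r | rewrite Z23_addgg].
Qed.

Lemma Z23_add_eq (g h k : Z23) : (g + h == k) = (g == k + h).
Proof. by apply/eqP/eqP => [<-|->]; rewrite Z23_addK. Qed.

Definition indep (g h k : Z23) : bool :=
  [&& g != 0, h != 0, k != 0, g != h, h != k, k != g & g + h + k != 0].

Lemma indep_rot g h k : indep g h k -> indep h k g.
Proof.
case/and5P => g0 h0 k0 gh /and3P[hk kg ghk].
by rewrite /indep g0 h0 k0 gh hk kg /= addrC addrA.
Qed.

(* For the gradings considered, only the values of [eps] at distinct nonzero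
   degrees matter, and the Jacobi identity only constrains independent triples. *)
Definition jacobi_map (F : fieldType) (eps : Z23 -> Z23 -> F) : Prop :=
  (forall g h, g != 0 -> h != 0 -> g != h -> eps g h = eps h g) /\
  (forall g h k, indep g h k ->
     eps g (h + k) * eps h k = eps h (k + g) * eps k g).

Definition idx (s : Z23) : 'I_8 := odflt 0 [pick i | tnth gdeg i == s].

Lemma idxK s : tnth gdeg (idx s) = s.
Proof.
rewrite /idx; case: pickP => [i /eqP //|/=].
by have [i <-] := gdeg_surj s; move/(_ i); rewrite eqxx.
Qed.

Lemma gdegK i : idx (tnth gdeg i) = i.
Proof. by apply: tnth_gdeg_inj; rewrite idxK. Qed.

Lemma mem_gdeg g : g \in (gdeg : seq Z23).
Proof. by have [i <-] := gdeg_surj g; apply: mem_tnth. Qed.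

Lemma indep_check (P : Z23 -> Z23 -> Z23 -> bool) :
  all (fun g => all (fun h => all (fun k => indep g h k ==> P g h k) gdeg) gdeg) gdeg ->
  forall g h k, indep g h k -> P g h k.
Proof.
move=> /allP H g h k; apply/implyP.
have /allP Hg := H g (mem_gdeg g); have /allP Hh := Hg h (mem_gdeg h).
exact: Hh (mem_gdeg k).
Qed.

Lemma indep_ex g h : g != 0 -> h != 0 -> g != h -> exists k, indep g h k.
Proof.
move=> g0 h0 gh; apply/existsP; move: g h g0 h0 gh.
suff H : all (fun g => all (fun h =>
  [&& g != 0, h != 0 & g != h] ==> has (indep g h) gdeg) gdeg) gdeg.
  move=> g h g0 h0 gh; have /allP/(_ g (mem_gdeg g))/allP/(_ h (mem_gdeg h)) := H.
  by rewrite g0 h0 gh => /hasP[k _ ?]; apply/existsP; exists k.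
by vm_compute.
Qed.

Section Model.
Variables (F : fieldType) (L : {vspace 'End(oct F)}).
Hypothesis hL : L = b3 F \/ L = d4 F.

Notation V := (subvs_of L).
Notation br := (@bracket F L).
Notation Gam := (@Gamma F L).
Notation contr := (contract br Gam).

Definition ent (x : V) (s t : Z23) : F := vsval x (oct_e F (idx s)) 0 (idx t).

Lemma ent_inj (x y : V) : (forall s t, ent x s t = ent y s t) -> x = y.
Proof.
move=> E; apply/val_inj/end_entry => i j.
by have := E (tnth gdeg i) (tnth gdeg j); rewrite /ent !gdegK.
Qed.

Lemma ent_linear a (x y : V) s t : ent (a *: x + y) s t = a * ent x s t + ent y s t.
Proof. by rewrite /ent linearP add_lfunE scale_lfunE !mxE. Qed.

Lemma entZ a (x : V) s t : ent (a *: x) s t = a * ent x s t.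
Proof. by rewrite /ent linearZ scale_lfunE !mxE. Qed.

Lemma entN (x : V) s t : ent (- x) s t = - ent x s t.
Proof. by rewrite -scaleN1r entZ mulN1r. Qed.

Lemma ent0 s t : ent 0 s t = 0.
Proof. by rewrite -[0](scale0r 0) entZ mul0r. Qed.

Lemma GammaP g (x : V) :
  x \in Gam g <-> forall s t, t != g + s -> ent x s t = 0.
Proof.
split=> [/Gamma_entry xg s t ts|xg]; first by apply: xg; rewrite !idxK.
apply/Gamma_entry => i j /xg; by rewrite /ent !gdegK.
Qed.

Lemma ent_skew (x : V) s t : ent x s t = - ent x t s.
Proof.
apply/eqP; rewrite -addr_eq0; apply/eqP.
have : vsval x \in d4 F by have := subvsP x; case: hL x => -> x // /memv_b3[].
by move/d4_entry; apply.
Qed.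

Lemma ent_bracket (x y : V) s t :
  ent (br x y) s t = \sum_r (ent y s r * ent x r t - ent x s r * ent y r t).
Proof.
rewrite /ent vsval_bracket // gl_bracketE !mxE.
have E (f h : 'End(oct F)) i j :
    f (h (oct_e F i)) 0 j = \sum_r h (oct_e F i) 0 (idx r) * f (oct_e F (idx r)) 0 j.
  rewrite {1}(oct_sum (h (oct_e F i))) linear_sum summxE.
  rewrite [RHS](reindex (tnth gdeg)) /=; last first.
    by exists idx => k _; rewrite ?gdegK ?idxK.
  by apply: eq_bigr => k _; rewrite linearZ mxE gdegK.
by rewrite !E -sumrB.
Qed.

Lemma bracket_linear_l z : linear (br^~ z : V -> V).
Proof.
move=> a x y; apply: ent_inj => s t; rewrite ent_linear !ent_bracket.
rewrite mulr_sumr -big_split; apply: eq_bigr => r _ /=.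
by rewrite !ent_linear; ring.
Qed.

Lemma br_antisym x y : br x y = - br y x.
Proof.
apply: ent_inj => s t; rewrite entN !ent_bracket -sumrN; apply: eq_bigr => r _.
by ring.
Qed.

Lemma br_jacobi x y z : br x (br y z) + br y (br z x) + br z (br x y) = 0.
Proof.
apply/val_inj/lfunP => v; rewrite !linearD /= !add_lfunE !vsval_bracket //.
rewrite !gl_bracketE !linearB /= zero_lfunE.
by apply/rowP => i; rewrite !mxE; ring.
Qed.

Definition co g (x : V) (s : Z23) : F := ent x s (s + g).

Lemma coZ g a x s : co g (a *: x) s = a * co g x s.
Proof. exact: entZ. Qed.

Lemma coN g x s : co g (- x) s = - co g x s.
Proof. exact: entN. Qed.

Lemma co_inj g x y : x \in Gam g -> y \in Gam g -> co g x =1 co g y -> x = y.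
Proof.
move=> /GammaP xg /GammaP yg E; apply: ent_inj => s t.
have [->|ts] := eqVneq t (g + s); last by rewrite xg ?yg.
by rewrite addrC; apply: E.
Qed.

Lemma co_skew g x s : co g x (s + g) = - co g x s.
Proof. by rewrite /co Z23_addK ent_skew. Qed.

Lemma Gamma_bracket g h x y : x \in Gam g -> y \in Gam h -> br x y \in Gam (g + h).
Proof. by case: (Gamma_is_grading hL) => _ _; apply. Qed.

Lemma co_br g h x y s : x \in Gam g -> y \in Gam h ->
  co (g + h) (br x y) s
    = co h y s * co g x (s + h) - co g x s * co h y (s + g).
Proof.
move=> /GammaP xg /GammaP yh; rewrite /co ent_bracket sumrB.
congr (_ - _).
  rewrite (bigD1 (s + h)) //= big1 ?addr0 => [|r nr].
    by rewrite addrAC addrA.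
  by rewrite (yh s) ?mul0r // addrC.
rewrite (bigD1 (s + g)) //= big1 ?addr0 ?addrA // => r nr.
by rewrite (xg s) ?mul0r // addrC.
Qed.

Lemma co_surj g (xi : Z23 -> F) : xi 0 = 0 ->
  (forall s, xi (s + g) = - xi s) -> exists2 x, x \in Gam g & co g x =1 xi.
Proof.
move=> xi0 xig.
pose a (i j : 'I_8) : F :=
  if tnth gdeg j == g + tnth gdeg i then xi (tnth gdeg i) else 0.
have ad4 : mx_end a \in d4 F.
  apply/d4_entry => i j; rewrite !mx_endE /a.
  have -> : (tnth gdeg i == g + tnth gdeg j) = (tnth gdeg j == g + tnth gdeg i).
    by apply/eqP/eqP => ->; rewrite Z23_addKl.
  by case: eqP => [->|_]; rewrite ?addr0 // (addrC g) xig subrr.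
have aL : mx_end a \in L.
  case: hL => -> //; apply/b3_entry; split=> // j; rewrite mx_endE /a.
  by case: eqP => // _; rewrite -xi0.
have aE s t : ent (vsproj L (mx_end a)) s t = if t == g + s then xi s else 0.
  by rewrite /ent vsprojK // mx_endE /a !idxK.
exists (vsproj L (mx_end a)); first by apply/GammaP => s t /negPf ts; rewrite aE ts.
by move=> s; rewrite /co aE addrC eqxx.
Qed.

Lemma Gam0 x : x \in Gam 0 -> (2 : F) != 0 -> x = 0.
Proof.
move=> x0 two; apply: co_inj (x0) _ _ => [|s]; first exact: mem0v.
have /eqP := co_skew 0 x s; rewrite addr0 -addr_eq0 -mulr2n -mulr_natl mulf_eq0.
by rewrite (negPf two) => /eqP ->; rewrite /co ent0.
Qed.

(** These are the skew matrices with entries 1 and -1 joining s and s + g. Neither index is 0, so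
    they kill e_0 and belong to b_3 too. *)
Lemma elementary g s : s != 0 -> g != 0 -> s != g ->
  exists2 x, x \in Gam g &
    forall t, co g x t = (t == s)%:R - (t == s + g)%:R.
Proof.
move=> s0 g0 sg; apply: (@co_surj g (fun t => (t == s)%:R - (t == s + g)%:R)).
  by rewrite eq_sym (negPf s0) eq_sym Z23_add_eq0 (negPf sg) subr0.
by move=> t; rewrite Z23_add_eq (inj_eq (addIr g)) opprB.
Qed.

Lemma br_same_degree g x y : x \in Gam g -> y \in Gam g -> br x y = 0.
Proof.
move=> xg yg; apply: (co_inj (Gamma_bracket xg yg)) => [|s]; first exact: mem0v.
by rewrite co_br // !co_skew // /co ent0; ring.
Qed.

(* [x], [y], [z] are elementary matrices along the path h, h + g, g, g + k, which
   avoids 0 so that they lie in b_3. *)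
Lemma path_triple g h k : indep g h k -> exists x y z,
  [/\ x \in Gam g, y \in Gam h, z \in Gam k, br z x = 0 & br x (br y z) != 0].
Proof.
move=> ind.
have /and5P[g0 h0 k0 gh /and3P[hk kg ghk]] := ind.
have [x xg xE] : exists2 x, x \in Gam g &
    forall t, co g x t = (t == h)%:R - (t == h + g)%:R.
  by apply: elementary; rewrite // eq_sym.
have [y yh yE] : exists2 y, y \in Gam h &
    forall t, co h y t = (t == h + g)%:R - (t == h + g + h)%:R.
  by apply: elementary => //; [rewrite Z23_add_eq0 eq_sym | rewrite addrC Z23_add_eq Z23_addgg].
have [z zk zE] : exists2 z, z \in Gam k &
    forall t, co k z t = (t == g)%:R - (t == g + k)%:R.
  by apply: elementary; rewrite // eq_sym.
exists x, y, z; split=> //.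
  apply: (co_inj (Gamma_bracket zk xg)) => [|s]; first exact: mem0v.
  rewrite (co_br _ zk xg) [RHS]/co ent0 !xE !zE.
  have := @indep_check (fun g h k => all (fun s =>
    ((s == h) || (s == h + g) ==> (s + g != g) && (s + g != g + k)) &&
    ((s == g) || (s == g + k) ==> (s + k != h) && (s + k != h + g))) gdeg) isT g h k ind.
  move=> /allP/(_ s (mem_gdeg s))/andP[].
  case: (s == h) (s == h + g) (s + g == g) (s + g == g + k) => [] [] [] [] //= _;
  case: (s == g) (s == g + k) (s + k == h) (s + k == h + g) => [] [] [] [] //= _;
  by rewrite ?subrr ?(mul0r, mulr0) ?subrr.
apply/negP => /eqP E.
have := co_br h xg (Gamma_bracket yh zk); rewrite E (co_br _ yh zk) (co_br _ yh zk) {1}/co ent0.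
rewrite !xE !yE !zE !eqxx.
have := @indep_check (fun g h k => [&& h + (h + k) != h, h + (h + k) != h + g,
    h != h + g, h + g != g, h + g != g + k, h + g != h + g + h, h + g + h == g &
    h + g + h != g + k]) isT g h k ind.
case/and5P=> /negPf-> /negPf-> /negPf-> /negPf-> /and4P[/negPf-> /negPf-> -> /negPf->].
by rewrite !subr0 mulr0 mul0r !mul1r !sub0r opprK => /esym/eqP; rewrite oner_eq0.
Qed.

(** In coordinates (ad x)^2 is a diagonal part, minus a sum of two squares, plus a cross term from s
    + g. Scalar actions are then obtained by making the cross term vanish, through the choice of x
    or through that of y. *)
Lemma co_double g h x y s : x \in Gam g -> y \in Gam h ->
  co h (br x (br x y)) s = 2 * co g x s * co g x (s + h) * co h y (s + g)
    - (co g x s ^+ 2 + co g x (s + h) ^+ 2) * co h y s.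
Proof.
move=> xg yh; have -> : co h (br x (br x y)) s = co (g + (g + h)) (br x (br x y)) s.
  by rewrite Z23_addKl.
rewrite (co_br _ xg (Gamma_bracket xg yh)) !(co_br _ xg yh) -!addrA Z23_addgg addr0 (addrC g h).
by rewrite !addrA !co_skew; ring.
Qed.

(** The coefficients of [x] are 1 and -1 on the cosets of {0, g} through h and k, and 0 on the other
    two. Translation by any of the four degrees [l] exchanges these two pairs of cosets, so exactly
    one of s and s + l is in the support: the cross term of [co_double] vanishes and the sum of
    squares is 1. *)
Lemma square_root_minus_one g h k : indep g h k -> exists2 x, x \in Gam g &
  forall l y, l \in [:: h; h + g; k; k + g] -> y \in Gam l -> br x (br x y) = - y.
Proof.
move=> ind; have /and5P[g0 h0 k0 gh /and3P[hk kg _]] := ind.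
pose xi t : F := (t == h)%:R - (t == h + g)%:R + ((t == k)%:R - (t == k + g)%:R).
have xi0 : xi 0 = 0.
  rewrite /xi ![0 == _]eq_sym !Z23_add_eq0 (negPf h0) (negPf k0) [h == g]eq_sym.
  by rewrite (negPf gh) (negPf kg) !subr0 addr0.
have xig t : xi (t + g) = - xi t.
  by rewrite /xi !Z23_add_eq !Z23_addK; ring.
have [x xg xE] := co_surj xi0 xig.
exists x => // l y lh yl; apply: (@co_inj l) => [||s].
- by rewrite -(Z23_addKl g l); apply: Gamma_bracket => //; apply: Gamma_bracket.
- by rewrite memvN.
rewrite (co_double _ xg yl) !xE /xi coN.
have := @indep_check (fun g h k => all (fun s => all (fun l =>
    (s == h) + (s == h + g)%R + ((s == k) + (s == k + g)%R) +
    ((s + l == h)%R + (s + l == h + g)%R + ((s + l == k)%R + (s + l == k + g)%R))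
      == 1)%N [:: h; h + g; k; k + g]) gdeg) isT g h k ind.
move=> /allP/(_ s (mem_gdeg s))/allP/(_ l lh).
case: (s == h) (s == h + g) (s == k) (s == k + g) => [] [] [] [] //=;
case: (s + l == h) (s + l == h + g) (s + l == k) (s + l == k + g) => [] [] [] [] //= _;
by ring.
Qed.

(** The scalar is tested on the elementary matrix joining s and s + h, whose coefficient at s + g is
    0, so that only the diagonal part of [co_double] remains. *)
Lemma double_scalar g h t a s : g != 0 -> h != 0 -> g != h -> s != 0 -> s != h ->
  t \in Gam g -> (forall y, y \in Gam h -> br t (br t y) = a *: y) ->
  a = - (co g t s ^+ 2 + co g t (s + h) ^+ 2).
Proof.
move=> g0 h0 gh s0 sh tg ta; have [y yh yE] := elementary s0 h0 sh.
have /(congr1 (fun v => co h v s)) := ta y yh; rewrite (co_double _ tg yh) coZ !yE.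
have /negPf-> : s + g != s by rewrite addrC Z23_add_eq Z23_addgg.
have /negPf-> : s + g != s + h by rewrite (inj_eq (addrI s)).
have /negPf-> : s != s + h by rewrite eq_sym addrC Z23_add_eq Z23_addgg.
by rewrite eqxx !subr0 !mulr1 mulr0 add0r => <-.
Qed.

(* Twice either scalar is the same symmetric function of the squared
   coefficients of [t]. *)
Lemma double_scalar_eq g h k t a b : indep g h k -> t \in Gam g ->
  (forall y, y \in Gam h -> br t (br t y) = a *: y) ->
  (forall y, y \in Gam k -> br t (br t y) = b *: y) -> (2 : F) != 0 -> a = b.
Proof.
move=> /and5P[g0 h0 k0 gh /and3P[hk kg _]] tg ta tb two; rewrite eq_sym in kg.
have kh : k != h by rewrite eq_sym.
have sq u : co g t (g + u) ^+ 2 = co g t u ^+ 2 by rewrite addrC co_skew sqrrN.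
have a1 := double_scalar g0 h0 gh g0 gh tg ta.
have a2 := double_scalar g0 h0 gh k0 kh tg ta.
have b1 := double_scalar g0 k0 kg g0 kg tg tb.
have b2 := double_scalar g0 k0 kg h0 hk tg tb.
have a12 : a + a = b + b.
  rewrite [X in X + _ = _]a1 [X in _ + X = _]a2 [X in _ = X + _]b1 [X in _ = _ + X]b2.
  by rewrite (sq h) (sq k) (addrC k h); set c := co g t; ring.
by apply: (mulfI two); rewrite !mulr_natl.
Qed.

(** * Automorphisms permuting the basis of the octonions *)

Definition relabel (tau : Z23 -> Z23) (x : V) : V :=
  vsproj L (mx_end (fun i j => ent x (tau (tnth gdeg i)) (tau (tnth gdeg j)))).

Lemma relabel_linear tau : linear (relabel tau).
Proof.
move=> a x y; rewrite /relabel -linearP; congr (vsproj L _); apply: end_entry => i j.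
by rewrite add_lfunE scale_lfunE !mxE !mx_endE ent_linear.
Qed.

HB.instance Definition _ tau :=
  GRing.isLinear.Build F V V _ (relabel tau) (relabel_linear tau).

(** Relabelling both indices preserves skew-symmetry, and the vanishing of row 0 since tau fixes 0.
    The signs of the octonion product, which a collineation need not respect, enter neither
    condition. *)
Lemma ent_relabel tau x s t : tau 0 = 0 ->
  ent (relabel tau x) s t = ent x (tau s) (tau t).
Proof.
move=> tau0; set a := (fun i j => ent x (tau (tnth gdeg i)) (tau (tnth gdeg j))).
suff aL : mx_end a \in L by rewrite /ent vsprojK // mx_endE /a !idxK.
have ad4 : mx_end a \in d4 F.
  by apply/d4_entry => i j; rewrite !mx_endE /a [X in _ + X]ent_skew subrr.
have memL W (f : 'End(oct F)) : L = W -> (f \in L) = (f \in W) by move=> ->.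
case: hL => [Lb3|Ld4]; last by rewrite (memL _ _ Ld4).
have := subvsP x; rewrite !(memL _ _ Lb3) => /b3_entry[_ x0].
apply/b3_entry; split=> // j; rewrite mx_endE /a.
have -> : tnth gdeg 0 = 0 by [].
have idx0 : idx 0 = 0 by apply: tnth_gdeg_inj; rewrite idxK.
by rewrite tau0 /ent idx0.
Qed.

Lemma relabel_automorphism (sigma tau : Z23 -> Z23) :
  {morph sigma : g h / g + h} -> {morph tau : g h / g + h} ->
  cancel sigma tau -> cancel tau sigma ->
  [/\ cancel (relabel tau) (relabel sigma),
      forall g x, x \in Gam g -> relabel tau x \in Gam (sigma g) &
      forall x y, relabel tau (br x y) = br (relabel tau x) (relabel tau y)].
Proof.
move=> sD tD st ts.
have s0 : sigma 0 = 0 by have := Z23_addgg (sigma 0); rewrite -sD addr0.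
have t0 : tau 0 = 0 by have := Z23_addgg (tau 0); rewrite -tD addr0.
split=> [x|g x /GammaP xg|x y].
- by apply: ent_inj => s t; rewrite !ent_relabel // !st.
- apply/GammaP => s t; rewrite ent_relabel // => nst; apply: xg.
  by apply: contra_neq nst => E; rewrite -(ts t) E sD ts.
apply: ent_inj => s t; rewrite ent_relabel // !ent_bracket (reindex tau) /=.
  by apply: eq_bigr => r _; rewrite !ent_relabel.
by exists sigma => r _.
Qed.

End Model.

(* The common properties of the gradings of b_3 and d_4 on which the whole
   classification rests. *)
Record so_graded (F : fieldType) (V : vectType F) (br : V -> V -> V)
    (Gam : Z23 -> {vspace V}) : Prop := SoGraded {
  so_grading : is_grading br Gam;
  so_linear : forall a x y z, br (a *: x + y) z = a *: br x z + br y z;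
  so_antisym : forall x y, br x y = - br y x;
  so_jacobi : forall x y z, br x (br y z) + br y (br z x) + br z (br x y) = 0;
  so_degree0 : forall x, x \in Gam 0 -> x = 0;
  so_same_degree : forall g x y, x \in Gam g -> y \in Gam g -> br x y = 0;
  so_path_triple : forall g h k, indep g h k -> exists x y z,
    [/\ x \in Gam g, y \in Gam h, z \in Gam k, br z x = 0 & br x (br y z) != 0];
  so_square_root : forall g h k, indep g h k -> exists2 x, x \in Gam g &
    forall l y, l \in [:: h; h + g; k; k + g] -> y \in Gam l -> br x (br x y) = - y;
  so_double_scalar : forall g h k t a b, indep g h k -> t \in Gam g ->
    (forall y, y \in Gam h -> br t (br t y) = a *: y) ->
    (forall y, y \in Gam k -> br t (br t y) = b *: y) -> a = b;
  so_automorphism : forall sigma tau : Z23 -> Z23,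
    {morph sigma : g h / g + h} -> {morph tau : g h / g + h} ->
    cancel sigma tau -> cancel tau sigma ->
    exists A B : 'End(V), [/\ cancel A B, cancel B A,
      forall g x, x \in Gam g -> A x \in Gam (sigma g),
      forall g x, x \in Gam g -> B x \in Gam (tau g) &
      forall x y, A (br x y) = br (A x) (A y)] }.

Lemma Gamma_so_graded (F : fieldType) (L : {vspace 'End(oct F)}) :
  L = b3 F \/ L = d4 F -> (2 : F) != 0 -> so_graded (@bracket F L) (@Gamma F L).
Proof.
move=> hL two; split.
- exact: Gamma_is_grading.
- by move=> a x y z; apply: bracket_linear_l.
- exact: br_antisym.
- exact: br_jacobi.
- by move=> x /(Gam0 hL); apply.
- exact: br_same_degree.
- exact: path_triple.
- exact: square_root_minus_one.
- by move=> *; apply: double_scalar_eq; eauto.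
- move=> sigma tau sD tD st ts.
  have [AB AG Abr] := relabel_automorphism hL sD tD st ts.
  have [BA BG _] := relabel_automorphism hL tD sD ts st.
  pose A := linfun (@relabel F L tau : subvs_of L -> subvs_of L).
  pose B := linfun (@relabel F L sigma : subvs_of L -> subvs_of L).
  have AE x : A x = relabel tau x by rewrite lfunE.
  have BE x : B x = relabel sigma x by rewrite lfunE.
  exists A, B; split=> [x|x|g x xg|g x xg|x y]; rewrite !(AE, BE).
  + exact: AB.
  + exact: BA.
  + exact: AG.
  + exact: BG.
  + exact: Abr.
Qed.

(** * Contractions and equivalences *)

Section Contractions.
Variables (F : fieldType) (V : vectType F) (br : V -> V -> V).
Variable Gam : Z23 -> {vspace V}.
Hypothesis so : so_graded br Gam.
Hypothesis two : (2 : F) != 0.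

Notation contr := (contract br Gam).
Notation hc := (hcomp Gam).

Let grL := so_grading so.

Lemma Gam_br g h x y : x \in Gam g -> y \in Gam h -> br x y \in Gam (g + h).
Proof. by have [_ _] := grL; apply. Qed.

Lemma brDl x y z : br (x + y) z = br x z + br y z.
Proof. by rewrite -[x]scale1r (so_linear so) !scale1r. Qed.

Lemma br0x x : br 0 x = 0.
Proof. by have := so_linear so (-1) 0 0 x; rewrite !scaleN1r oppr0 add0r addNr. Qed.

Lemma brZl a x y : br (a *: x) y = a *: br x y.
Proof. by rewrite -[_ *: _]addr0 (so_linear so) br0x addr0. Qed.

Lemma brDr x y z : br z (x + y) = br z x + br z y.
Proof. by rewrite !(so_antisym so z) brDl opprD. Qed.

Lemma brx0 x : br x 0 = 0.
Proof. by rewrite (so_antisym so) br0x oppr0. Qed.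

Lemma brZr a x y : br x (a *: y) = a *: br x y.
Proof. by rewrite !(so_antisym so x) brZl scalerN. Qed.

Lemma hcomp_mem g x : hc g x \in Gam g.
Proof. exact: memv_sum_pi. Qed.

Lemma hcomp_sum x : x = \sum_g hc g x.
Proof. by have [E _ _] := grL; rewrite sumv_pi_sum // E memvf. Qed.

Lemma Gam_ind (P : V -> Prop) : (forall x y, P x -> P y -> P (x + y)) ->
  (forall g x, x \in Gam g -> P x) -> forall x, P x.
Proof.
move=> PD PG x; rewrite (hcomp_sum x); apply: big_ind => //.
  by apply: (PG 0); apply: mem0v.
by move=> g _; apply: PG (hcomp_mem g x).
Qed.

Lemma contr_homog eps g h x y : x \in Gam g -> y \in Gam h ->
  contr eps x y = eps g h *: br x y.
Proof. exact: (contractE grL br0x brx0). Qed.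

Lemma contr_linear_l eps z : linear (contr eps ^~ z).
Proof.
move=> a x y; rewrite /contract scaler_sumr -big_split; apply: eq_bigr => g _.
rewrite /= scaler_sumr -big_split; apply: eq_bigr => h _ /=.
move: (hc g) (hc h) => p q.
by rewrite linearP (so_linear so) scalerDr !scalerA mulrC.
Qed.

Lemma contr_linear_r eps z : linear (contr eps z).
Proof.
move=> a x y; rewrite /contract scaler_sumr -big_split; apply: eq_bigr => g _.
rewrite /= scaler_sumr -big_split; apply: eq_bigr => h _ /=.
move: (hc g) (hc h) => p q.
by rewrite linearP brDr brZr scalerDr !scalerA mulrC.
Qed.

Lemma contrDl eps x y z : contr eps (x + y) z = contr eps x z + contr eps y z.
Proof. by rewrite -[x]scale1r contr_linear_l !scale1r. Qed.

Lemma contrDr eps x y z : contr eps z (x + y) = contr eps z x + contr eps z y.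
Proof. by rewrite -[x]scale1r contr_linear_r !scale1r. Qed.

(** Two rotations put g and h in the last two places of a path triple, whose inner bracket cannot
    vanish. *)
Lemma br_nonzero g h : g != 0 -> h != 0 -> g != h ->
  exists x y, [/\ x \in Gam g, y \in Gam h & br x y != 0].
Proof.
move=> g0 h0 gh; have [k /indep_rot/indep_rot ind] := indep_ex g0 h0 gh.
have [u [x [y [_ xg yh _ nz]]]] := so_path_triple so ind.
by exists x, y; split=> //; apply/eqP => E; rewrite E brx0 eqxx in nz.
Qed.

Lemma triple_homog eps g h k x y z : x \in Gam g -> y \in Gam h -> z \in Gam k ->
  contr eps x (contr eps y z) = (eps g (h + k) * eps h k) *: br x (br y z).
Proof.
move=> xg yh zk; rewrite (contr_homog _ yh zk).
rewrite (contr_homog _ xg (memvZ _ (Gam_br yh zk))).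
by rewrite brZr scalerA.
Qed.

Let J eps x y z := contr eps x (contr eps y z) + contr eps y (contr eps z x)
  + contr eps z (contr eps x y).

Lemma jacobi_map_degenerate eps g k x y z : jacobi_map eps ->
  x \in Gam g -> y \in Gam g -> z \in Gam k -> J eps x y z = 0.
Proof.
case=> epsC _ xg yg zk; rewrite /J.
rewrite (triple_homog _ xg yg zk) (triple_homog _ yg zk xg) (triple_homog _ zk xg yg).
rewrite [br x y](so_same_degree so xg yg) brx0 scaler0 addr0.
have := so_jacobi so x y z; rewrite [br x y](so_same_degree so xg yg) brx0 addr0.
move/eqP; rewrite addr_eq0 => /eqP ->; rewrite scalerN addrC.
have [k0|k0] := eqVneq k 0.
  by rewrite (so_degree0 so (x:=z)) -?k0 // br0x brx0 !scaler0 subrr.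
have [g0|g0] := eqVneq g 0.
  by rewrite (so_degree0 so (x:=x)) -?g0 // !brx0 !scaler0 subrr.
have [gk|gk] := eqVneq g k.
  by rewrite -gk in zk; rewrite (so_same_degree so zk xg) brx0 !scaler0 subrr.
by rewrite (epsC g k) // [k + g]addrC subrr.
Qed.

Lemma jacobi_mapP eps : jacobi_map eps <-> graded_contraction br Gam eps.
Proof.
split=> [epsJ|[_ _ alt jac]].
  have [epsC epsG] := epsJ.
  have anti x y : contr eps x y = - contr eps y x.
    elim/Gam_ind: x => [x x' Ex Ex'|g x xg].
      by rewrite contrDl contrDr Ex Ex' opprD.
    elim/Gam_ind: y => [y y' Ey Ey'|h y yh].
      by rewrite contrDl contrDr Ey Ey' opprD.
    rewrite (contr_homog _ xg yh) (contr_homog _ yh xg) (so_antisym so y) scalerN opprK.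
    have [g0|g0] := eqVneq g 0.
      by rewrite (so_degree0 so (x:=x)) -?g0 // br0x !scaler0.
    have [h0|h0] := eqVneq h 0.
      by rewrite (so_degree0 so (x:=y)) -?h0 // brx0 !scaler0.
    have [gh|gh] := eqVneq g h; last by rewrite epsC.
    by rewrite -gh in yh; rewrite (so_same_degree so xg yh) !scaler0.
  split; [exact: contr_linear_r | exact: contr_linear_l | |].
    move=> x; have /eqP := anti x x; rewrite -addr_eq0 -mulr2n -scaler_nat.
    by rewrite scaler_eq0 (negPf two) => /eqP.
  have Jrot x y z : J eps x y z = J eps y z x by rewrite /J addrAC addrC addrA addrAC.
  have JD x x' y z : J eps (x + x') y z = J eps x y z + J eps x' y z.
    rewrite /J contrDl (contrDr _ x x' z) (contrDl _ x x' y) !contrDr.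
    by rewrite (addrACA (contr eps x _)) (addrACA (_ + contr eps y (contr eps z x))).
  suff Jh g h k x y z : x \in Gam g -> y \in Gam h -> z \in Gam k -> J eps x y z = 0.
    move=> x y z; rewrite -/(J eps x y z).
    elim/Gam_ind: x => [x x' Ex Ex'|g x xg]; first by rewrite JD Ex Ex' addr0.
    rewrite Jrot; elim/Gam_ind: y => [y y' Ey Ey'|h y yh].
      by rewrite JD Ey Ey' addr0.
    rewrite Jrot; elim/Gam_ind: z => [z z' Ez Ez'|k z zk].
      by rewrite JD Ez Ez' addr0.
    by rewrite Jrot (Jh g h k).
  move=> xg yh zk.
  have [gh|gh] := eqVneq g h.
    by apply: (@jacobi_map_degenerate eps h k) => //; rewrite -gh.
  have [hk|hk] := eqVneq h k.
    by rewrite Jrot; apply: (@jacobi_map_degenerate eps k g) => //; rewrite -hk.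
  have [kg|kg] := eqVneq k g.
    by rewrite Jrot Jrot; apply: (@jacobi_map_degenerate eps g h) => //; rewrite -kg.
  have m0 u : contr eps 0 u = 0 /\ contr eps u 0 = 0.
    have m00 : contr eps 0 u = 0.
      by have := contr_linear_l eps u (-1) 0 0; rewrite !scaleN1r oppr0 add0r addNr.
    by split=> //; rewrite anti m00 oppr0.
  have [g0|g0] := eqVneq g 0.
    by rewrite /J (so_degree0 so (x:=x)) -?g0 // !(m0 _).1 !(m0 _).2 !addr0.
  have [h0|h0] := eqVneq h 0.
    by rewrite /J (so_degree0 so (x:=y)) -?h0 // !(m0 _).1 !(m0 _).2 !addr0.
  have [k0|k0] := eqVneq k 0.
    by rewrite /J (so_degree0 so (x:=z)) -?k0 // !(m0 _).1 !(m0 _).2 !addr0.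
  rewrite /J (triple_homog _ xg yh zk) (triple_homog _ yh zk xg) (triple_homog _ zk xg yh).
  (* On a line each double bracket is a bracket of two elements of the same degree. *)
  have [ghk|ghk] := eqVneq (g + h + k) 0.
    have Eg : g = h + k by apply/eqP; rewrite -Z23_add_eq0 addrA ghk.
    have Eh : h = k + g by apply/eqP; rewrite Eg addrC Z23_addK.
    have Ek : k = g + h by apply/eqP; rewrite Eg addrAC Z23_addgg add0r.
    have -> : br x (br y z) = 0 by apply: (so_same_degree so xg); rewrite Eg; apply: Gam_br.
    have -> : br y (br z x) = 0 by apply: (so_same_degree so yh); rewrite Eh; apply: Gam_br.
    have -> : br z (br x y) = 0 by apply: (so_same_degree so zk); rewrite Ek; apply: Gam_br.
    by rewrite !scaler0 !addr0.
  have ind : indep g h k by rewrite /indep g0 h0 k0 gh hk kg ghk.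
  have ind' := indep_rot ind.
  rewrite (epsG _ _ _ ind) (epsG _ _ _ ind') -!scalerDr.
  by rewrite (so_jacobi so) scaler0.
have anti x y : contr eps x y = - contr eps y x.
  apply/eqP; rewrite -addr_eq0; have := alt (x + y).
  by rewrite contrDl !contrDr !alt add0r addr0 => ->.
split=> [g h g0 h0 gh|g h k ind].
  have [x [y [xg yh nz]]] := br_nonzero g0 h0 gh.
  have /eqP := anti x y; rewrite (contr_homog _ xg yh) (contr_homog _ yh xg).
  rewrite (so_antisym so y) scalerN opprK -subr_eq0 -scalerBl scaler_eq0 (negPf nz).
  by rewrite orbF subr_eq0 => /eqP.
(* The letters are rotated so that the two terms surviving [z, x] = 0 carry exactly the two
   coefficients to be compared. *)
move: ind => /indep_rot; move: h k g => g h k ind.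
have [x [y [z [xg yh zk zx nz]]]] := so_path_triple so ind.
have := jac x y z; have := so_jacobi so x y z.
rewrite (triple_homog _ xg yh zk) (triple_homog _ yh zk xg) (triple_homog _ zk xg yh).
rewrite zx brx0 scaler0 !addr0 => /eqP; rewrite addr_eq0 => /eqP ->.
rewrite scalerN addrC; move/eqP; rewrite subr_eq0 -subr_eq0 -scalerBl scaler_eq0.
case/orP => [|/eqP z0]; first by rewrite subr_eq0 => /eqP.
(* If [z, [x, y]] were 0, the original Jacobi identity would also kill [x, [y, z]]. *)
have := so_jacobi so x y z; rewrite zx z0 brx0 !addr0 => E.
by rewrite E eqxx in nz.
Qed.

(** * Construction of equivalences *)

Lemma equivI eps eps' (f f' : 'End(V)) (s s' : Z23 -> Z23) :
  cancel f f' -> cancel f' f -> cancel s s' ->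
  (forall g x, x \in Gam g -> f x \in Gam (s g)) ->
  (forall g x, x \in Gam g -> f' x \in Gam (s' g)) ->
  (forall g h x y, x \in Gam g -> y \in Gam h ->
     eps g h *: f (br x y) = eps' (s g) (s h) *: br (f x) (f y)) ->
  contraction_equiv br Gam eps eps'.
Proof.
move=> ff' f'f ss' fG f'G fbr; exists f; split; first by exists f'.
  elim/Gam_ind => [x x' Ex Ex' y|g x xg].
    by rewrite !(contrDl, linearD) /= Ex Ex'.
  elim/Gam_ind => [y y' Ey Ey'|h y yh].
    by rewrite !(contrDr, linearD) /= Ey Ey'.
  by rewrite (contr_homog _ xg yh) linearZ /= fbr // -contr_homog // fG.
move=> g; exists (s g); apply/eqP; rewrite eqEsubv; apply/andP; split.
  by apply/subvP => _ /memv_imgP[x xg ->]; apply: fG.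
apply/subvP => y /f'G; rewrite ss' => f'y; rewrite -(f'f y).
exact: memv_img.
Qed.

Lemma equiv_refl eps : contraction_equiv br Gam eps eps.
Proof.
apply: (@equivI _ _ \1%VF \1%VF id id) => [x|x|x|g x|g x|g h x y _ _];
  by rewrite ?id_lfunE.
Qed.

Lemma equiv_trans eps1 eps2 eps3 : contraction_equiv br Gam eps1 eps2 ->
  contraction_equiv br Gam eps2 eps3 -> contraction_equiv br Gam eps1 eps3.
Proof.
case=> f [fb fh fG] [f' [fb' fh' fG']]; exists (f' \o f)%VF; split.
- by apply: (eq_bij (bij_comp fb' fb)) => x; rewrite comp_lfunE.
- by move=> x y; rewrite !comp_lfunE fh fh'.
- move=> g; have [h Eh] := fG g; have [k Ek] := fG' h; exists k.
  by rewrite limg_comp Eh.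
Qed.

Definition glue (phi : Z23 -> 'End(V)) : 'End(V) := (\sum_g (phi g \o hc g))%VF.

Lemma glueE phi g x : x \in Gam g -> glue phi x = phi g x.
Proof.
move=> xg; rewrite sum_lfunE.
have E k : (phi k \o hc k)%VF x = phi k (if k == g then x else 0).
  by rewrite comp_lfunE; congr (phi k _); apply: (hcompE grL).
rewrite (eq_bigr _ (fun k _ => E k)) (bigD1 g) //= eqxx big1 ?addr0 // => k /negPf->.
exact: linear0.
Qed.

Lemma lfun_homog_eq (f f' : 'End(V)) : (forall g x, x \in Gam g -> f x = f' x) -> f =1 f'.
Proof. by move=> E; elim/Gam_ind => // x y Ex Ey; rewrite !linearD /= Ex Ey. Qed.

Lemma equiv_scale eps eps' (b : Z23 -> F) : (forall g, b g != 0) ->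
  (forall g h, g != 0 -> h != 0 -> g != h ->
     eps g h * b (g + h) = eps' g h * (b g * b h)) ->
  contraction_equiv br Gam eps eps'.
Proof.
move=> b0 bE; pose phi (c : Z23 -> F) := glue (fun g => c g *: \1%VF).
have phiE c g x : x \in Gam g -> phi c x = c g *: x.
  by move=> xg; rewrite /phi (glueE _ xg) scale_lfunE id_lfunE.
have phiG c g x : x \in Gam g -> phi c x \in Gam g.
  by move=> xg; rewrite (phiE _ _ _ xg) memvZ.
have phiK c d : (forall g, c g * d g = 1) -> cancel (phi c) (phi d).
  move=> cd x; rewrite -comp_lfunE -[RHS](id_lfunE x); apply: lfun_homog_eq => g {}x xg.
  by rewrite comp_lfunE (phiE d g) ?phiG // (phiE c g) // scalerA mulrC cd scale1r id_lfunE.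
apply: (@equivI _ _ (phi b) (phi (fun g => (b g)^-1)) id id) => //.
- by apply: phiK => g; rewrite mulfV.
- by apply: phiK => g; rewrite mulVf.
- exact: phiG.
- exact: phiG.
move=> g h x y xg yh; rewrite (phiE _ _ _ xg) (phiE _ _ _ yh).
rewrite (phiE _ _ _ (Gam_br xg yh)) brZl brZr !scalerA.
have [g0|g0] := eqVneq g 0.
  by rewrite (so_degree0 so (x:=x)) -?g0 // br0x !scaler0.
have [h0|h0] := eqVneq h 0.
  by rewrite (so_degree0 so (x:=y)) -?h0 // brx0 !scaler0.
have [gh|gh] := eqVneq g h.
  by rewrite -gh in yh; rewrite (so_same_degree so xg yh) !scaler0.
by rewrite bE // mulrA.
Qed.

Lemma equiv_collineation eps eps' (sigma tau : Z23 -> Z23) :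
  {morph sigma : g h / g + h} -> {morph tau : g h / g + h} ->
  cancel sigma tau -> cancel tau sigma ->
  (forall g h, eps g h = eps' (sigma g) (sigma h)) ->
  contraction_equiv br Gam eps eps'.
Proof.
move=> sD tD st ts epsE.
have [A [B [AB BA AG BG Abr]]] := so_automorphism so sD tD st ts.
by apply: (equivI AB BA st AG BG) => g h x y xg yh; rewrite Abr epsE.
Qed.

(* On [Gam h] and [Gam (g + h)] the isomorphism is the bracket with an element
   [z] of [Gam g] such that (ad z)^2 = -1 there; [ad z] commutes with [ad x] for
   [x] in [Gam g]. *)
Lemma equiv_swap eps eps' g h (sw : Z23 -> Z23) : g != 0 -> h != 0 -> g != h ->
  sw h = g + h -> sw (g + h) = h ->
  (forall u, u \notin [:: h; g + h] -> sw u = u) ->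
  (forall u v, eps u v = eps' (sw u) (sw v)) ->
  (forall u v, u != 0 -> v != 0 -> u != v -> eps u v != 0 -> (u == g) || (v == g)) ->
  contraction_equiv br Gam eps eps'.
Proof.
move=> g0 h0 gh swh swgh swid epsE epsg.
have [k ind] := indep_ex g0 h0 gh; have [z zg zz] := so_square_root so ind.
have adlin c : linear (fun x => c *: br z x).
  by move=> a x y; rewrite brDr brZr scalerDr !scalerA mulrC.
pose ad c := linfun (HB.pack_for {linear V -> V} (fun x => c *: br z x)
  (GRing.isLinear.Build F V V _ (fun x => c *: br z x) (adlin c))).
have adE c x : ad c x = c *: br z x by rewrite lfunE.
pose P := [:: h; g + h].
pose phi c := glue (fun u => if u \in P then ad c else \1%VF).
have phiE1 c u x : u \in P -> x \in Gam u -> phi c x = c *: br z x.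
  by move=> uP xu; rewrite /phi (glueE _ xu) uP adE.
have phiE0 c u x : u \notin P -> x \in Gam u -> phi c x = x.
  by move=> /negPf uP xu; rewrite /phi (glueE _ xu) uP id_lfunE.
have swP u : u \in P -> sw u = g + u /\ g + u \in P.
  by rewrite !inE => /orP[] /eqP ->; rewrite ?swh ?swgh ?Z23_addKl !eqxx ?orbT.
have phiG c u x : x \in Gam u -> phi c x \in Gam (sw u).
  move=> xu; have [uP|uP] := boolP (u \in P).
    by rewrite (phiE1 c u) // (swP u uP).1 memvZ // Gam_br.
  by rewrite (phiE0 c u) // swid.
have phiK c d : c * d = -1 -> cancel (phi c) (phi d).
  move=> cd x; rewrite -comp_lfunE -[RHS](id_lfunE x); apply: lfun_homog_eq => u {}x xu.
  rewrite comp_lfunE id_lfunE; have [uP|uP] := boolP (u \in P); last by rewrite !(phiE0 _ u).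
  rewrite (phiE1 c u) // (phiE1 d (g + u)) ?(swP u uP).2 ?memvZ ?Gam_br //.
  rewrite brZr scalerA mulrC cd scaleN1r (zz u) ?opprK //.
  by move: uP; rewrite !inE addrC => /orP[] ->; rewrite ?orbT.
have swK : cancel sw sw.
  move=> u; have [uP|uP] := boolP (u \in P); last by rewrite !swid // swid.
  by rewrite (swP u uP).1 (swP _ (swP u uP).2).1 Z23_addKl.
(* Since (ad z)^2 = -1 on the two exchanged components, the inverse of ad z there is -ad z. *)
apply: (@equivI _ _ (phi 1) (phi (-1)) sw sw) => //.
- by apply: phiK; rewrite mul1r.
- by apply: phiK; rewrite mulr1.
- exact: phiG.
- exact: phiG.
move=> u v x y xu yv; rewrite -epsE.
have [u0|u0] := eqVneq u 0.
  by rewrite (so_degree0 so (x:=x)) -?u0 // linear0 !br0x linear0.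
have [v0|v0] := eqVneq v 0.
  by rewrite (so_degree0 so (x:=y)) -?v0 // linear0 !brx0 linear0.
have [uv|uv] := eqVneq u v.
  rewrite -uv in yv; rewrite (so_same_degree so xu yv) linear0.
  by rewrite (so_same_degree so (phiG _ _ _ xu) (phiG _ _ _ yv)).
have [->|nz] := eqVneq (eps u v) 0; first by rewrite !scale0r.
congr (_ *: _).
have ggP : g \notin P.
  by rewrite !inE negb_or gh addrC eq_sym Z23_add_eq Z23_addgg h0.
have comm a b w : a \in Gam g -> b \in Gam w -> phi 1 (br a b) = br (phi 1 a) (phi 1 b).
  move=> ag bw; rewrite (phiE0 1 g a) //; have [wP|wP] := boolP (w \in P).
    rewrite (phiE1 1 w b) // (phiE1 1 (g + w)) ?(swP w wP).2 ?Gam_br // !scale1r.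
    have := so_jacobi so z a b; rewrite (so_same_degree so zg ag) brx0 addr0.
    rewrite (so_antisym so b) -(scaleN1r (br z b)) brZr scaleN1r => /eqP.
    by rewrite subr_eq0 => /eqP.
  rewrite (phiE0 1 w b) // (phiE0 1 (g + w)) ?Gam_br //.
  apply: contra wP => /swP[_]; by rewrite Z23_addKl.
case/orP: (epsg u v u0 v0 uv nz) => /eqP Eg; rewrite Eg in xu yv.
  exact: comm xu yv.
by rewrite (so_antisym so x) (so_antisym so (phi 1 x)) linearN /= (comm _ _ _ yv xu).
Qed.

(** * What an equivalence preserves *)

Lemma Gam_nonzero g : g != 0 -> exists2 x, x \in Gam g & x != 0.
Proof.
move=> g0; have [h h0 gh] : exists2 h : Z23, h != 0 & g != h.
  have [->|g1] := eqVneq g (tnth gdeg 1); first by exists (tnth gdeg 2).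
  by exists (tnth gdeg 1).
have [x [y [xg _ nz]]] := br_nonzero g0 h0 gh.
by exists x => //; apply: contra_neq nz => ->; rewrite br0x.
Qed.

Lemma Gam_disjoint g h x : x \in Gam g -> x \in Gam h -> x != 0 -> g = h.
Proof.
move=> xg xh x0; apply/eqP; apply: contra_neqT x0 => /negPf gh.
by have := hcompE grL g xh; rewrite (hcompE grL g xg) eqxx gh.
Qed.

(** Distinct nonzero degrees have distinct nonzero components and degree 0 has the zero component,
    so the chosen map on degrees is determined by f, injective, and fixes 0. *)
Lemma equivE eps eps' : contraction_equiv br Gam eps eps' ->
  exists (f : 'End(V)) (s : Z23 -> Z23), [/\ injective f, injective s, s 0 = 0,
    forall g, (f @: Gam g)%VS = Gam (s g) &
    forall g h x y, x \in Gam g -> y \in Gam h ->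
      eps g h *: f (br x y) = eps' (s g) (s h) *: br (f x) (f y)].
Proof.
case=> f [fb fh fG]; have finj := bij_inj fb.
have [s sE] := choice fG.
have fin g x : x \in Gam g -> f x \in Gam (s g) by move=> xg; rewrite -sE memv_img.
have fout g x : f x \in Gam (s g) -> x \in Gam g.
  by rewrite -sE => /memv_imgP[y yg /finj->].
have f0 x : x != 0 -> f x != 0.
  by apply: contra_neq => E; apply: finj; rewrite E linear0.
have s0 g : s g = 0 -> g = 0.
  move=> sg; apply/eqP/negPn/negP => /Gam_nonzero[x /fin]; rewrite sg => /(so_degree0 so) E.
  by move=> /f0; rewrite E eqxx.
have sinj : injective s.
  move=> g h E; have [g0|g0] := eqVneq g 0.
    apply/esym; rewrite g0; apply: s0; rewrite -E.
    apply/eqP/negPn/negP => /Gam_nonzero[y]; rewrite -sE => /memv_imgP[x xg ->].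
    by rewrite g0 in xg; rewrite (so_degree0 so xg) linear0 eqxx.
  have [x xg x0] := Gam_nonzero g0.
  by apply: (Gam_disjoint xg _ x0); apply: fout; rewrite -E; apply: fin.
exists f, s; split=> //.
  apply/eqP/negPn/negP => /Gam_nonzero[y]; rewrite -sE => /memv_imgP[x x0 ->].
  by rewrite (so_degree0 so x0) linear0 eqxx.
move=> g h x y xg yh; rewrite -(contr_homog eps' (fin _ _ xg) (fin _ _ yh)) -fh.
by rewrite (contr_homog _ xg yh) linearZ.
Qed.

Section Equivalent.
Variables (eps eps' : Z23 -> Z23 -> F) (f : 'End(V)) (s : Z23 -> Z23).
Hypotheses (finj : injective f) (sinj : injective s) (s0 : s 0 = 0).
Hypothesis fG : forall g, (f @: Gam g)%VS = Gam (s g).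
Hypothesis fbr : forall g h x y, x \in Gam g -> y \in Gam h ->
  eps g h *: f (br x y) = eps' (s g) (s h) *: br (f x) (f y).

Let fin g x : x \in Gam g -> f x \in Gam (s g).
Proof. by move=> xg; rewrite -fG memv_img. Qed.

Let sn0 g : g != 0 -> s g != 0.
Proof. by apply: contra_neq => E; apply: sinj; rewrite s0. Qed.

(** No two distinct components of nonzero degree commute in the original algebra, in the source as
    in the target, so a vanishing coefficient on either side forces the other to vanish. *)
Lemma equiv_support g h : g != 0 -> h != 0 -> g != h ->
  (eps' (s g) (s h) != 0) = (eps g h != 0).
Proof.
move=> g0 h0 gh; apply/idP/idP; apply: contra_neq => E.
  have sgh : s g != s h by rewrite (inj_eq sinj).
  have [u [v [ug vh nz]]] := br_nonzero (sn0 g0) (sn0 h0) sgh.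
  move: ug vh nz; rewrite -!fG => /memv_imgP[x xg ->] /memv_imgP[y yh ->] /negPf nz.
  have /eqP := fbr xg yh; rewrite E scale0r eq_sym scaler_eq0 nz orbF => /eqP E'.
  by rewrite E'.
have [x [y [xg yh nz]]] := br_nonzero g0 h0 gh.
have fnz : f (br x y) != 0.
  by apply: contra_neq nz => E1; apply: finj; rewrite E1 linear0.
by have /eqP := fbr xg yh; rewrite E scale0r scaler_eq0 (negPf fnz) orbF => /eqP.
Qed.

(** A nonzero multiple of f [x, y] lies both in the image of the component g + h and in the
    component s g + s h, and distinct components meet only in 0. *)
Lemma equiv_add g h : g != 0 -> h != 0 -> g != h -> eps g h != 0 ->
  s (g + h) = s g + s h.
Proof.
move=> g0 h0 gh nz; have [x [y [xg yh xy0]]] := br_nonzero g0 h0 gh.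
have fnz : eps g h *: f (br x y) != 0.
  rewrite scaler_eq0 (negPf nz) /=.
  by apply: contra_neq xy0 => E1; apply: finj; rewrite E1 linear0.
apply: Gam_disjoint fnz; first by rewrite memvZ // fin // Gam_br.
by rewrite (fbr xg yh) memvZ // Gam_br // fin.
Qed.

(* [x] with (ad x)^2 = -1 on [Gam h] and [Gam k] is sent to [f x], whose squared
   adjoint action is scalar on [Gam (s h)] and on [Gam (s k)]; the two scalars,
   read off from [fbr], must be equal. *)
Lemma equiv_ratio g h k : indep g h k ->
  eps g h * eps g (g + h) != 0 -> eps g k * eps g (g + k) != 0 ->
  eps g h * eps g (g + h) * (eps' (s g) (s k) * eps' (s g) (s g + s k))
  = eps g k * eps g (g + k) * (eps' (s g) (s h) * eps' (s g) (s g + s h)).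
Proof.
move=> ind ph pk; have /and5P[g0 h0 k0 gh /and3P[hk kg ghk]] := ind.
have [x xg xx] := so_square_root so ind.
have scal l : l \in [:: h; k] -> l != 0 -> g != l -> eps g l * eps g (g + l) != 0 ->
    s (g + l) = s g + s l /\ exists c, c * (eps' (s g) (s l) * eps' (s g) (s g + s l))
        = - (eps g l * eps g (g + l)) /\ eps' (s g) (s l) * eps' (s g) (s g + s l) != 0 /\
      forall y, y \in Gam (s l) -> br (f x) (br (f x) y) = c *: y.
  move=> lhk l0 gl; rewrite mulf_eq0 negb_or => /andP[nz1 nz2].
  have sgl := equiv_add g0 l0 gl nz1; split=> //.
  have gl0 : g + l != 0 by rewrite Z23_add_eq0.
  have ggl : g != g + l.
    by rewrite eq_sym addrC Z23_add_eq Z23_addgg.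
  have nz1' : eps' (s g) (s l) != 0 by rewrite equiv_support.
  have nz2' : eps' (s g) (s g + s l) != 0 by rewrite -sgl equiv_support.
  have nz' := mulf_neq0 nz1' nz2'.
  exists (- (eps g l * eps g (g + l)) / (eps' (s g) (s l) * eps' (s g) (s g + s l))).
  split; first by rewrite divfK.
  split=> // y'; rewrite -fG => /memv_imgP[y yl ->].
  apply: (scalerI nz'); rewrite scalerA [_ * (_ / _)]mulrC divfK //.
  rewrite -sgl mulrC -scalerA -brZr -(fbr xg yl) brZr scalerA mulrC -scalerA.
  rewrite -(fbr xg (Gam_br xg yl)) scalerA (xx l y _ yl); last first.
    by move: lhk; rewrite !inE => /orP[] ->; rewrite ?orbT.
  by rewrite linearN scalerN scaleNr.
have [shE [c [cE [c0 cc]]]] := scal h (mem_head _ _) h0 gh ph.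
have gk : g != k by rewrite eq_sym.
have kin : k \in [:: h; k] by rewrite !inE eqxx orbT.
have [skE [d [dE [d0 dd]]]] := scal k kin k0 gk pk.
have ind' : indep (s g) (s h) (s k).
  rewrite /indep !sn0 //= !(inj_eq sinj) gh hk kg -shE Z23_add_eq0 (inj_eq sinj).
  by rewrite -Z23_add_eq0.
have cd := so_double_scalar so ind' (fin xg) cc dd.
have -> : eps g h * eps g (g + h) = - (c * (eps' (s g) (s h) * eps' (s g) (s g + s h))).
  by rewrite cE opprK.
have -> : eps g k * eps g (g + k) = - (d * (eps' (s g) (s k) * eps' (s g) (s g + s k))).
  by rewrite dE opprK.
by rewrite cd; ring.
Qed.
End Equivalent.
End Contractions.

(** * Supports *)

Section Search.
Variables (A : eqType) (dom : seq A) (ok fin : seq A -> bool).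

(* Sequences are extended at the head, and a branch is cut as soon as [ok]
   fails. *)
Fixpoint search n acc : bool :=
  if ok acc then
    if n is n'.+1 then all (fun x => search n' (x :: acc)) dom else fin acc
  else true.

(** The partial sequences met on the way to r are its suffixes. They all pass [ok], so the branch
    leading to r is never cut. *)
Lemma searchP n r : search n (drop n r) -> (n <= size r)%N ->
  {subset r <= dom} -> (forall k, ok (drop k r)) -> fin r.
Proof.
move=> + + rdom okr; elim: n => [|n IHn] /=; first by rewrite okr drop0.
rewrite okr => /allP H nr; apply: IHn; last exact: ltnW.
have [x _] : exists x : A, True by case: r nr {H rdom okr} => // x; exists x.
by rewrite (drop_nth x nr); apply: H; apply: rdom; apply: mem_nth.
Qed.

End Search.

Definition gd (i : nat) : Z23 := nth 0 gdeg i.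

Definition gi (g : Z23) : nat := index g gdeg.

(* [fano_sum i j] is the label of g_i + g_j; it is i * j for distinct i, j > 0. *)
Definition fano_sum (i j : nat) : nat :=
  nth 0 (nth [::] [:: [:: 0; 1; 2; 3; 4; 5; 6; 7]; [:: 1; 0; 5; 6; 7; 2; 3; 4];
    [:: 2; 5; 0; 7; 6; 1; 4; 3]; [:: 3; 6; 7; 0; 5; 4; 1; 2];
    [:: 4; 7; 6; 5; 0; 3; 2; 1]; [:: 5; 2; 1; 4; 3; 0; 7; 6];
    [:: 6; 3; 4; 1; 2; 7; 0; 5]; [:: 7; 4; 3; 2; 1; 6; 5; 0]] i) j.

Lemma gi_lt g : (gi g < 8)%N.
Proof. by have := index_mem g gdeg; rewrite mem_gdeg size_tuple. Qed.

Lemma giK g : gd (gi g) = g.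
Proof. exact: nth_index (mem_gdeg g). Qed.

Lemma gdK i : (i < 8)%N -> gi (gd i) = i.
Proof. by move=> i8; rewrite /gi index_uniq ?size_tuple. Qed.

Lemma forall8 (P : pred nat) : all P (iota 0 8) -> forall i, (i < 8)%N -> P i.
Proof. by move=> /allP H i i8; apply: H; rewrite mem_iota. Qed.

Lemma forall8_2 (P : nat -> nat -> bool) :
  all (fun i => all (P i) (iota 0 8)) (iota 0 8) ->
  forall i j, (i < 8)%N -> (j < 8)%N -> P i j.
Proof. by move=> /forall8 H i j i8; apply: forall8; apply: H. Qed.

Lemma forall8_3 (P : nat -> nat -> nat -> bool) :
  all (fun i => all (fun j => all (P i j) (iota 0 8)) (iota 0 8)) (iota 0 8) ->
  forall i j k, (i < 8)%N -> (j < 8)%N -> (k < 8)%N -> P i j k.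
Proof. by move=> /forall8_2 H i j k i8 j8; apply: forall8; apply: H. Qed.

Lemma gdD i j : (i < 8)%N -> (j < 8)%N -> gd i + gd j = gd (fano_sum i j).
Proof.
move=> i8 j8; apply/eqP; move: i j i8 j8.
by apply: (@forall8_2 (fun i j => gd i + gd j == gd (fano_sum i j))); vm_compute.
Qed.

Lemma fano_sum_lt i j : (i < 8)%N -> (j < 8)%N -> (fano_sum i j < 8)%N.
Proof. by apply: (@forall8_2 (fun i j => fano_sum i j < 8)%N); vm_compute. Qed.

Lemma giD g h : gi (g + h) = fano_sum (gi g) (gi h).
Proof.
by rewrite -{1}(giK g) -{1}(giK h) gdD ?gi_lt // gdK // fano_sum_lt ?gi_lt.
Qed.

Definition nindep (i j k : nat) : bool :=
  if uniq [:: 0%N; i; j; k] then fano_sum i j != k else false.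

Lemma indep_gd i j k : (i < 8)%N -> (j < 8)%N -> (k < 8)%N ->
  indep (gd i) (gd j) (gd k) = nindep i j k.
Proof.
move=> i8 j8 k8; apply/eqP; move: i j k i8 j8 k8.
by apply: (@forall8_3 (fun i j k => indep (gd i) (gd j) (gd k) == nindep i j k)); vm_compute.
Qed.

Definition labels : seq nat := iota 0 8.

(** A pair that is not an edge gets the index 21, the number of edges, at which [ebit] reads the
    default false. *)
Definition edge_index : seq (seq nat) := Eval vm_compute in
  [seq [seq index (minn i j, maxn i j) edges_X | j <- labels] | i <- labels].

Definition ebit (S : bitseq) (i j : nat) : bool :=
  nth false S (nth 21 (nth [::] edge_index i) j).

(** A triple (p, q, r) of edge indices stands for the implication: if p and q are in the support, so
    is r. If one side of a Jacobi relation is nonzero, both factors of the rotated side are, which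
    gives two clauses for each independent triple. *)
Definition clauses : seq (nat * nat * nat) := Eval vm_compute in
  let ix i j := nth 21 (nth [::] edge_index i) j in
  flatten [seq flatten [seq flatten [seq if nindep i j k then
    [:: (ix i (fano_sum j k), ix j k, ix j (fano_sum k i));
        (ix i (fano_sum j k), ix j k, ix k i)] else [::]
    | k <- labels] | j <- labels] | i <- labels].

Definition sat (S : bitseq) (c : nat * nat * nat) : bool :=
  if nth false S c.1.1 then if nth false S c.1.2 then nth false S c.2 else true else true.

(* The clauses whose least index is o, shifted by o: they can be tested on the
   part of the support already chosen. *)
Definition clauses_from : seq (seq (nat * nat * nat)) := Eval vm_compute in
  [seq [seq (c.1.1 - o, c.1.2 - o, c.2 - o)%N
       | c <- clauses & minn (minn c.1.1 c.1.2) c.2 == o] | o <- iota 0 22].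

Definition sat_from (S : bitseq) : bool :=
  all (sat S) (nth [::] clauses_from (21 - size S)).

Lemma nice_sat_from S k : size S = 21%N -> all (sat S) clauses -> sat_from (drop k S).
Proof.
move=> S21 /allP nS; apply/allP => c; rewrite size_drop S21.
have [k21|k21] := leqP k 21%N; last first.
  have /eqP-> : (21 - k == 0)%N by rewrite subn_eq0 ltnW.
  by rewrite subn0.
rewrite subKn // => ck.
have /nS : (k + c.1.1, k + c.1.2, k + c.2)%N \in clauses.
  have /allP/(_ k) : all (fun k => all (fun c => (k + c.1.1, k + c.1.2, k + c.2)%N \in clauses)
    (nth [::] clauses_from k)) (iota 0 22) by vm_compute.
  by rewrite mem_iota => /(_ k21)/allP/(_ c ck).
by rewrite /sat /= !nth_drop.
Qed.

(** A linear bijection is given by the images a, b, c of the basis g_1, g_2, g_3; the other entries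
    follow from g_4 = g_1 + g_2 + g_3, g_5 = g_1 + g_2, g_6 = g_1 + g_3 and g_7 = g_2 + g_3. There
    are 7 * 6 * 4 = 168 of them. *)
Definition collineations : seq (seq nat) := Eval vm_compute in
  flatten [seq flatten [seq flatten [seq if nindep a b c then
    [:: [:: 0; a; b; c; fano_sum a (fano_sum b c); fano_sum a b; fano_sum a c; fano_sum b c]]
    else [::]
    | c <- labels] | b <- labels] | a <- labels].

Definition additive_labels (p : seq nat) : bool :=
  all (fun i => all (fun j =>
    fano_sum (nth 0 p i) (nth 0 p j) == nth 0 p (fano_sum i j)) labels) labels.

Definition inverse_labels (p q : seq nat) : bool :=
  all (fun i => (nth 0 p i < 8) && (nth 0 q (nth 0 p i) == i))%N labels.

Definition inv_labels (p : seq nat) : seq nat := [seq index i p | i <- labels].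

Lemma collineationsP p : p \in collineations -> let q := inv_labels p in
  [&& additive_labels p, additive_labels q, inverse_labels p q & inverse_labels q p].
Proof.
move=> pc; apply: (allP (_ : all (fun p => let q := inv_labels p in [&& additive_labels p,
  additive_labels q, inverse_labels p q & inverse_labels q p]) collineations) p pc).
by vm_compute.
Qed.

Definition act (p : seq nat) (g : Z23) : Z23 := gd (nth 0 p (gi g)).

Lemma act_collineation p : p \in collineations -> exists q,
  [/\ {morph act p : x y / x + y}, {morph act q : x y / x + y},
      cancel (act p) (act q) & cancel (act q) (act p)].
Proof.
move=> /collineationsP/and4P[]; set q := inv_labels p => pD qD pq qp; exists q.
have actD r s : additive_labels r -> inverse_labels r s -> {morph act r : x y / x + y}.
  move=> rD rs g h; rewrite /act giD gdD; first last.
  - by have /andP[] := forall8 rs (gi_lt h).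
  - by have /andP[] := forall8 rs (gi_lt g).
  congr gd; apply/esym/eqP.
  pose P i j := fano_sum (nth 0%N r i) (nth 0%N r j) == nth 0%N r (fano_sum i j).
  exact: (@forall8_2 P rD _ _ (gi_lt g) (gi_lt h)).
have actK r s : inverse_labels r s -> cancel (act r) (act s).
  move=> rs g; have /andP[r8 /eqP sr] := forall8 rs (gi_lt g).
  by rewrite /act gdK // sr giK.
by split; [apply: actD pD pq | apply: actD qD qp | apply: actK pq | apply: actK qp].
Qed.

Definition T_indices : seq nat := iota 1 24.

Definition T_bits : seq bitseq := Eval vm_compute in
  [seq [seq e \in T t | e <- edges_X] | t <- T_indices].

Definition label_edges : seq (nat * nat) := Eval vm_compute in edges_X.

Fixpoint same_bits (S : bitseq) (p : seq nat) (es : seq (nat * nat)) (tb : bitseq) : bool :=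
  match es, tb with
  | e :: es', b :: tb' =>
      if ebit S (nth 0 p e.1) (nth 0 p e.2) (+) b then false else same_bits S p es' tb'
  | _, _ => true
  end.

(** This is [has], written with [if] so that evaluation by value stops at the first witness instead
    of computing both arguments of a disjunction. *)
Fixpoint first_true (A : Type) (f : pred A) (s : seq A) : bool :=
  if s is x :: s' then if f x then true else first_true f s' else false.

Lemma first_trueE (A : Type) (f : pred A) s : first_true f s = has f s.
Proof. by elim: s => //= x s ->; case: (f x). Qed.

Definition standard (S : bitseq) : bool :=
  first_true (fun tb => if count id S == count id tb
    then first_true (fun p => same_bits S p label_edges tb) collineations else false) T_bits.

(** The bits are chosen from the last edge to the first, so each clause is tested as soon as its
    least index is reached. This pruning keeps the 2^21 subsets of X within reach. *)
Lemma nice_search : search [:: true; false] sat_from standard 21%N [::].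
Proof. by vm_compute. Qed.

Lemma label_edgesE : label_edges = edges_X.
Proof. by vm_compute. Qed.

Lemma standardP S : standard S -> exists p t, [/\ p \in collineations, t \in T_indices &
  forall e, e \in edges_X -> ebit S (nth 0 p e.1) (nth 0 p e.2) = (e \in T t)].
Proof.
rewrite /standard first_trueE => /hasP[tb tbT]; case: ifP => // _.
rewrite first_trueE => /hasP[p pc same].
have /mapP[t tT Etb] : tb \in [seq [seq e \in T t | e <- edges_X] | t <- T_indices].
  by have -> : [seq [seq e \in T t | e <- edges_X] | t <- T_indices] = T_bits by vm_compute.
exists p, t; split=> // e; rewrite -label_edgesE => eX.
move: same; rewrite {}Etb -label_edgesE; elim: label_edges eX => //= e' es IHes.
rewrite inE; case: ifP => // /negbT; rewrite negb_add => /eqP E; case/orP => [/eqP-> //|].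
exact: IHes.
Qed.

Definition supp (F : fieldType) (eps : Z23 -> Z23 -> F) : bitseq :=
  [seq eps (gd e.1) (gd e.2) != 0 | e <- edges_X].

Lemma mem_edges_X i j : (i < 8)%N -> (j < 8)%N ->
  ((i, j) \in edges_X) = (0 < i < j)%N.
Proof.
move=> i8 j8; apply/eqP; move: i j i8 j8.
by apply: (@forall8_2 (fun i j => ((i, j) \in edges_X) == (0 < i < j)%N)); vm_compute.
Qed.

Lemma gd_neq0 i : (0 < i < 8)%N -> gd i != 0.
Proof.
by case/andP => i0 i8; apply: contraTneq i0 => E; rewrite -(gdK i8) E.
Qed.

Lemma gd_eq i j : (i < 8)%N -> (j < 8)%N -> (gd i == gd j) = (i == j).
Proof. by move=> i8 j8; apply/eqP/eqP => [E|->//]; rewrite -(gdK i8) E gdK. Qed.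

Lemma jacobi_map_sym (F : fieldType) (eps : Z23 -> Z23 -> F) i j : jacobi_map eps ->
  (0 < i < 8)%N -> (0 < j < 8)%N -> i != j -> eps (gd i) (gd j) = eps (gd j) (gd i).
Proof.
case=> epsC _ i8 j8 ij; apply: epsC; rewrite ?gd_neq0 // gd_eq //.
  by case/andP: i8.
by case/andP: j8.
Qed.

Lemma ebit_supp (F : fieldType) (eps : Z23 -> Z23 -> F) i j : jacobi_map eps ->
  (0 < i < 8)%N -> (0 < j < 8)%N -> i != j ->
  ebit (supp eps) i j = (eps (gd i) (gd j) != 0).
Proof.
move=> epsJ i8 j8 ij; have [[i0 i8'] [j0 j8']] := (andP i8, andP j8).
rewrite /ebit.
have -> : nth 21 (nth [::] edge_index i) j = index (minn i j, maxn i j) edges_X.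
  apply/eqP; move: i j i8' j8' {i8 j8 ij i0 j0}.
  by apply: (@forall8_2 (fun i j => nth 21 (nth [::] edge_index i) j
    == index (minn i j, maxn i j) edges_X)); vm_compute.
have eX : (minn i j, maxn i j) \in edges_X.
  rewrite mem_edges_X ?gtn_min ?gtn_max ?i8' ?j8' //.
  by case: (ltngtP i j) ij => // lt _; rewrite ?i0 ?j0 ?lt ?orbT.
rewrite /supp (nth_map (0, 0)%N) ?index_mem // nth_index //=.
by case: (ltngtP i j) ij => // ij _; rewrite (jacobi_map_sym epsJ) // ltn_eqF.
Qed.

Lemma all_clauses S : (forall i j k, (i < 8)%N -> (j < 8)%N -> (k < 8)%N -> nindep i j k ->
    ebit S i (fano_sum j k) -> ebit S j k -> ebit S j (fano_sum k i) && ebit S k i) ->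
  all (sat S) clauses.
Proof.
move=> H; pose ix i j := nth 21 (nth [::] edge_index i) j.
have -> : clauses = flatten [seq flatten [seq flatten [seq if nindep i j k then
    [:: (ix i (fano_sum j k), ix j k, ix j (fano_sum k i));
        (ix i (fano_sum j k), ix j k, ix k i)] else [::]
    | k <- labels] | j <- labels] | i <- labels] by vm_compute.
have labP i : i \in labels -> (i < 8)%N by rewrite mem_iota.
apply/allP => c /flattenP[_ /mapP[i /labP li ->]] /flattenP[_ /mapP[j /labP lj ->]].
case/flattenP => _ /mapP[k /labP lk ->]; case: ifP => // ind.
have := H i j k li lj lk ind; rewrite /ebit => Hijk.
by rewrite !inE /sat => /orP[] /eqP-> /=; rewrite /ix;
  case: (nth false S _) Hijk => //; case: (nth false S _) => // /(_ isT isT)/andP[].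
Qed.

Lemma nindepP i j k : (i < 8)%N -> (j < 8)%N -> (k < 8)%N -> nindep i j k ->
  [/\ 0 < i, 0 < j, 0 < k, i != j & j != k]%N /\
  [/\ k != i, (0 < fano_sum j k)%N, (0 < fano_sum k i)%N,
      i != fano_sum j k & j != fano_sum k i].
Proof.
move=> i8 j8 k8 ind; move: (i8) (j8) (k8) ind.
suff H : forall i j k, (i < 8)%N -> (j < 8)%N -> (k < 8)%N -> nindep i j k ==>
    [&& [&& 0 < i, 0 < j, 0 < k, i != j & j != k]%N,
      k != i, (0 < fano_sum j k)%N, (0 < fano_sum k i)%N,
      i != fano_sum j k & j != fano_sum k i].
  by move=> /H{}H /H{}H /H/implyP{}H /H/andP[/and5P[-> -> -> -> ->] /and5P[-> -> -> -> ->]].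
by apply: forall8_3; vm_compute.
Qed.

Lemma jacobi_map_nat (F : fieldType) (eps : Z23 -> Z23 -> F) i j k : jacobi_map eps ->
  (i < 8)%N -> (j < 8)%N -> (k < 8)%N -> nindep i j k ->
  eps (gd i) (gd (fano_sum j k)) * eps (gd j) (gd k)
  = eps (gd j) (gd (fano_sum k i)) * eps (gd k) (gd i).
Proof.
move=> [_ epsJ] i8 j8 k8; rewrite -indep_gd // => /epsJ.
by rewrite !gdD.
Qed.

Lemma support_standard (F : fieldType) (eps : Z23 -> Z23 -> F) : jacobi_map eps ->
  exists p t, [/\ p \in collineations, t \in T_indices &
    forall e, e \in edges_X ->
      (eps (act p (gd e.1)) (act p (gd e.2)) != 0) = (e \in T t)].
Proof.
move=> epsJ; have S21 : size (supp eps) = 21%N by rewrite size_map.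
have : standard (supp eps).
  apply: (searchP (n := 21%N) (dom := [:: true; false]) (ok := sat_from)).
  - have -> : drop 21%N (supp eps) = [::] by rewrite drop_oversize ?S21.
    exact: nice_search.
  - by rewrite S21.
  - by move=> [].
  move=> k; apply: nice_sat_from => //; apply: all_clauses => i j l i8 j8 l8 ind.
  have [[i0 j0 l0 ij jl] [li jl0 li0 ijl jli]] := nindepP i8 j8 l8 ind.
  rewrite !ebit_supp ?i8 ?j8 ?l8 ?andbT ?fano_sum_lt ?i0 ?j0 ?l0 ?jl0 ?li0 //.
  move=> nz1 nz2; have := jacobi_map_nat epsJ i8 j8 l8 ind.
  move/(congr1 (fun x => x != 0)); rewrite (mulf_neq0 nz1 nz2) mulf_eq0 negb_or.
  by move=> /esym.
case/standardP => p [t [pc tT H]]; exists p, t; split=> // e eX.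
have : all (fun e => [&& e.1 < 8, e.2 < 8, e.1 != e.2, 0 < e.1 & 0 < e.2])%N edges_X.
  by vm_compute.
move=> /allP/(_ e eX)/and5P[e18 e28 e12 e10 e20].
have /and4P[pD _ pq _] := collineationsP pc; set q := inv_labels p in pq.
have pE i : (i < 8)%N -> act p (gd i) = gd (nth 0 p i) by move=> i8; rewrite /act gdK.
have p8 i : (i < 8)%N -> (nth 0 p i < 8)%N by move=> /(forall8 pq)/andP[].
have pinj i j : (i < 8)%N -> (j < 8)%N -> nth 0 p i = nth 0 p j -> i = j.
  move=> /(forall8 pq)/andP[_ /eqP E1] /(forall8 pq)/andP[_ /eqP E2] E.
  by rewrite -E1 -E2 E.
have p0 : nth 0%N p 0 = 0%N.
  have := @forall8_2 (fun i j => fano_sum (nth 0%N p i) (nth 0%N p j)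
    == nth 0%N p (fano_sum i j)) pD 0%N 0%N isT isT => /eqP <-.
  by case: (nth _ _ _) (p8 0%N isT) => [|[|[|[|[|[|[|[|]]]]]]]].
have pn0 i : (i < 8)%N -> (0 < i)%N -> (0 < nth 0 p i)%N.
  move=> i8; rewrite !lt0n; apply: contra_neq => E; apply: pinj => //.
  by rewrite E p0.
rewrite !pE // -H // ebit_supp ?p8 ?pn0 //.
by apply: contra_neq e12; apply: pinj.
Qed.

(** * Values on a given support *)

Section Rescaling.
Variable F : numClosedFieldType.
Implicit Types (a : nat -> nat -> F) (b : nat -> F).

(** Only the values [a i j] with i < j are meaningful. The test [Nat.ltb] is evaluated by
    simplification on numerals. *)
Definition sym_value a i j : F := if Nat.ltb j i then a j i else a i j.

Definition label_triple (i j k : nat) : bool :=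
  [&& i < 8, j < 8 & k < 8]%N && nindep i j k.

Definition jacobi_labels a : Prop := forall i j k, label_triple i j k ->
  sym_value a i (fano_sum j k) * sym_value a j k
  = sym_value a j (fano_sum k i) * sym_value a k i.

(* The values [v] on the edges [E] are obtained from [a] by rescaling the
   homogeneous components by [b]. *)
Fixpoint rescales a b (E : seq (nat * nat)) (v : seq F) : Prop :=
  match E, v with
  | e :: E', c :: v' =>
      a e.1 e.2 * b (fano_sum e.1 e.2) = c * (b e.1 * b e.2) /\ rescales a b E' v'
  | _, _ => True
  end.

Definition rescalable a (E : seq (nat * nat)) (v : seq F) : Prop :=
  exists2 s : seq F, all (fun x => x != 0) s & rescales a (nth 1 s) E v.

Lemma rescales_nth a b E v e : rescales a b E v -> e \in E -> size v = size E ->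
  a e.1 e.2 * b (fano_sum e.1 e.2) = nth 0 v (index e E) * (b e.1 * b e.2).
Proof.
elim: E v => // e' E IHE [|c v] //= [H Hv]; rewrite inE; rewrite [e' == e]eq_sym.
by case: eqVneq => [->|ne] //= eE [sz]; apply: IHE.
Qed.

Lemma nth_neq0 (s : seq F) i : all (fun x => x != 0) s -> nth 1 s i != 0.
Proof.
move=> /allP H; have [/(mem_nth 1)/H //|le] := ltnP i (size s).
by rewrite nth_default // oner_neq0.
Qed.

Lemma all_edges (P : nat * nat -> Prop) (E : seq (nat * nat)) :
  foldr (fun e Q => P e /\ Q) True E -> forall e, e \in E -> P e.
Proof. by elim: E => //= e E IHE [Pe PE] e'; rewrite inE => /orP[/eqP->|/IHE]; auto. Qed.

Ltac forced J E := have := J; rewrite /sym_value /= ?E ?(mul1r, mulr1).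

(** Each step here and in the next three lemmas is a Jacobi relation with three of its four factors
    already known to be 1. *)
Lemma propagate_T21 a : jacobi_labels a ->
  a 1 2 = 1 -> a 1 3 = 1 -> a 1 7 = 1 -> a 2 3 = 1 ->
  forall e, e \in T 21 -> a e.1 e.2 = 1.
Proof.
move=> J e12 e13 e17 e23.
have e26 : a 2 6 = 1 by forced (J 1 2 3 isT) (e13, e17, e23).
have e35 : a 3 5 = 1 by forced (J 3 1 2 isT) (e12, e17, e23).
by apply: all_edges; rewrite /=; do !split.
Qed.

Lemma propagate_T22 a : jacobi_labels a ->
  a 1 2 = 1 -> a 1 3 = 1 -> a 1 4 = 1 -> a 1 5 = 1 -> a 2 3 = 1 ->
  forall e, e \in T 22 -> a e.1 e.2 = 1.
Proof.
move=> J e12 e13 e14 e15 e23.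
have e56 : a 5 6 = 1 by forced (J 3 5 1 isT) (e13, e15, e23).
have e35 : a 3 5 = 1 by forced (J 1 3 5 isT) (e14, e15, e23).
have e17 : a 1 7 = 1 by forced (J 3 1 2 isT) (e12, e23, e35).
have e26 : a 2 6 = 1 by forced (J 2 3 1 isT) (e12, e13, e35).
have e16 : a 1 6 = 1 by forced (J 1 2 6 isT) (e14, e23, e26).
by apply: all_edges; rewrite /=; do !split.
Qed.

Lemma propagate_T23 a : jacobi_labels a ->
  a 1 2 = 1 -> a 1 3 = 1 -> a 1 4 = 1 -> a 1 5 = 1 -> a 2 3 = 1 -> a 2 4 = 1 ->
  forall e, e \in T 23 -> a e.1 e.2 = 1.
Proof.
move=> J e12 e13 e14 e15 e23 e24.
have e56 : a 5 6 = 1 by forced (J 3 5 1 isT) (e13, e15, e23).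
have e35 : a 3 5 = 1 by forced (J 1 3 5 isT) (e14, e15, e23).
have e57 : a 5 7 = 1 by forced (J 4 5 1 isT) (e14, e15, e24).
have e45 : a 4 5 = 1 by forced (J 1 4 5 isT) (e13, e15, e24).
have e25 : a 2 5 = 1 by forced (J 2 3 5 isT) (e13, e24, e35).
have e17 : a 1 7 = 1 by forced (J 3 1 2 isT) (e12, e23, e35).
have e26 : a 2 6 = 1 by forced (J 2 3 1 isT) (e12, e13, e35).
have e16 : a 1 6 = 1 by forced (J 4 1 2 isT) (e12, e24, e45).
have e27 : a 2 7 = 1 by forced (J 2 4 1 isT) (e12, e14, e45).
by apply: all_edges; rewrite /=; do !split.
Qed.

(** The seven values assumed to be 1 match the seven scales of the nonzero components; the Jacobi
    relations leave no further freedom. *)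
Lemma propagate_T24 a : jacobi_labels a ->
  a 1 2 = 1 -> a 1 3 = 1 -> a 1 4 = 1 -> a 1 5 = 1 -> a 2 3 = 1 -> a 2 4 = 1 -> a 3 4 = 1 ->
  forall e, e \in T 24 -> a e.1 e.2 = 1.
Proof.
move=> J e12 e13 e14 e15 e23 e24 e34.
have e37 : a 3 7 = 1 by forced (J 1 3 4 isT) (e14, e15, e34).
have e46 : a 4 6 = 1 by forced (J 4 1 3 isT) (e13, e15, e34).
have e56 : a 5 6 = 1 by forced (J 3 5 1 isT) (e13, e15, e23).
have e35 : a 3 5 = 1 by forced (J 1 3 5 isT) (e14, e15, e23).
have e17 : a 1 7 = 1 by forced (J 1 3 7 isT) (e12, e34, e37).
have e67 : a 6 7 = 1 by forced (J 7 1 3 isT) (e12, e13, e37).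
have e57 : a 5 7 = 1 by forced (J 4 5 1 isT) (e14, e15, e24).
have e45 : a 4 5 = 1 by forced (J 1 4 5 isT) (e13, e15, e24).
have e16 : a 1 6 = 1 by forced (J 1 4 6 isT) (e12, e34, e46).
have e26 : a 2 6 = 1 by forced (J 6 1 5 isT) (e15, e17, e56).
have e27 : a 2 7 = 1 by forced (J 7 1 5 isT) (e15, e16, e57).
have e25 : a 2 5 = 1 by forced (J 2 3 5 isT) (e13, e24, e35).
have e36 : a 3 6 = 1 by forced (J 2 3 6 isT) (e12, e26, e34).
have e47 : a 4 7 = 1 by forced (J 2 4 7 isT) (e12, e27, e34).
by apply: all_edges; rewrite /=; do !split.
Qed.

Definition nonzero_on a (E : seq (nat * nat)) : Prop :=
  forall e, e \in E -> (a e.1 e.2 == 0) = false.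

Lemma square_root (x : F) : (x == 0) = false -> exists2 s, s ^+ 2 = x & (s == 0) = false.
Proof. by move=> x0; exists (sqrtC x); rewrite ?sqrtCK // sqrtC_eq0. Qed.

Lemma rescale_T2 a : nonzero_on a (T 2) ->
  rescalable a (T 2) (nseq 1 1).
Proof.
move=> nz.
have n12 : (a 1 2 == 0) = false := nz (1, 2)%N isT.
pose n1 := (oner_eq0 F, n12).
exists [:: 1; 1; 1; 1; 1; (a 1 2)^-1; 1; 1].
  by rewrite /= !(mulf_eq0, invr_eq0, n1).
by rewrite /=; do !split => //; field; rewrite ?n1.
Qed.

Lemma rescale_T3 a : nonzero_on a (T 3) ->
  rescalable a (T 3) (nseq 2 1).
Proof.
move=> nz.
have n12 : (a 1 2 == 0) = false := nz (1, 2)%N isT.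
have n13 : (a 1 3 == 0) = false := nz (1, 3)%N isT.
pose n1 := (oner_eq0 F, n12, n13).
exists [:: 1; 1; 1; 1; 1; (a 1 2)^-1; (a 1 3)^-1; 1].
  by rewrite /= !(mulf_eq0, invr_eq0, n1).
by rewrite /=; do !split => //; field; rewrite ?n1.
Qed.

(** Multiplying the conditions for 12 and 15, which lie on one line, cancels b_2 and b_5 and leaves
    b_1^2 = a_12 a_15; hence the root [s] for b_1. *)
Lemma rescale_T4 a : nonzero_on a (T 4) ->
  rescalable a (T 4) (nseq 2 1).
Proof.
move=> nz.
have n12 : (a 1 2 == 0) = false := nz (1, 2)%N isT.
have n15 : (a 1 5 == 0) = false := nz (1, 5)%N isT.
pose n0 := (n12, n15).
have [s s2 ns] := @square_root (a 1 2 * a 1 5)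
  ltac:(by rewrite !(mulf_eq0, invr_eq0, n0)).
pose n1 := (oner_eq0 F, n0, ns).
exists [:: 1; s; 1; 1; 1; s / a 1 2; 1; 1].
  by rewrite /= !(mulf_eq0, invr_eq0, n1).
by rewrite /=; do !split => //; field: s2; rewrite ?n1.
Qed.

Lemma rescale_T5 a : nonzero_on a (T 5) ->
  rescalable a (T 5) (nseq 2 1).
Proof.
move=> nz.
have n12 : (a 1 2 == 0) = false := nz (1, 2)%N isT.
have n67 : (a 6 7 == 0) = false := nz (6, 7)%N isT.
pose n1 := (oner_eq0 F, n12, n67).
exists [:: 1; a 1 2; 1; 1; 1; 1; a 6 7; 1].
  by rewrite /= !(mulf_eq0, invr_eq0, n1).
by rewrite /=; do !split => //; field; rewrite ?n1.
Qed.

Lemma rescale_T6 a : nonzero_on a (T 6) ->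
  rescalable a (T 6) (nseq 3 1).
Proof.
move=> nz.
have n12 : (a 1 2 == 0) = false := nz (1, 2)%N isT.
have n15 : (a 1 5 == 0) = false := nz (1, 5)%N isT.
have n25 : (a 2 5 == 0) = false := nz (2, 5)%N isT.
pose n0 := (n12, n15, n25).
have [s s2 ns] := @square_root (a 1 2 * a 1 5)
  ltac:(by rewrite !(mulf_eq0, invr_eq0, n0)).
have [r r2 nr] := @square_root (a 1 2 * a 2 5)
  ltac:(by rewrite !(mulf_eq0, invr_eq0, n0)).
pose n1 := (oner_eq0 F, n0, ns, nr).
exists [:: 1; s; r; 1; 1; s * r / a 1 2; 1; 1].
  by rewrite /= !(mulf_eq0, invr_eq0, n1).
by rewrite /=; do !split => //; field: s2 r2; rewrite ?n1.
Qed.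

Lemma rescale_T7 a : nonzero_on a (T 7) ->
  rescalable a (T 7) (nseq 3 1).
Proof.
move=> nz.
have n25 : (a 2 5 == 0) = false := nz (2, 5)%N isT.
have n36 : (a 3 6 == 0) = false := nz (3, 6)%N isT.
have n47 : (a 4 7 == 0) = false := nz (4, 7)%N isT.
pose n1 := (oner_eq0 F, n25, n36, n47).
exists [:: 1; 1; a 2 5; a 3 6; a 4 7; 1; 1; 1].
  by rewrite /= !(mulf_eq0, invr_eq0, n1).
by rewrite /=; do !split => //; field; rewrite ?n1.
Qed.

Lemma rescale_T8 a : nonzero_on a (T 8) ->
  rescalable a (T 8) (nseq 3 1).
Proof.
move=> nz.
have n12 : (a 1 2 == 0) = false := nz (1, 2)%N isT.
have n13 : (a 1 3 == 0) = false := nz (1, 3)%N isT.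
have n14 : (a 1 4 == 0) = false := nz (1, 4)%N isT.
pose n1 := (oner_eq0 F, n12, n13, n14).
exists [:: 1; 1; 1; 1; 1; (a 1 2)^-1; (a 1 3)^-1; (a 1 4)^-1].
  by rewrite /= !(mulf_eq0, invr_eq0, n1).
by rewrite /=; do !split => //; field; rewrite ?n1.
Qed.

Lemma rescale_T9 a : nonzero_on a (T 9) ->
  rescalable a (T 9) (nseq 3 1).
Proof.
move=> nz.
have n12 : (a 1 2 == 0) = false := nz (1, 2)%N isT.
have n13 : (a 1 3 == 0) = false := nz (1, 3)%N isT.
have n15 : (a 1 5 == 0) = false := nz (1, 5)%N isT.
pose n0 := (n12, n13, n15).
have [s s2 ns] := @square_root (a 1 2 * a 1 5)
  ltac:(by rewrite !(mulf_eq0, invr_eq0, n0)).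
pose n1 := (oner_eq0 F, n0, ns).
exists [:: 1; s; 1; 1; 1; s / a 1 2; s / a 1 3; 1].
  by rewrite /= !(mulf_eq0, invr_eq0, n1).
by rewrite /=; do !split => //; field: s2; rewrite ?n1.
Qed.

Lemma rescale_T10 a : nonzero_on a (T 10) ->
  rescalable a (T 10) (nseq 3 1).
Proof.
move=> nz.
have n12 : (a 1 2 == 0) = false := nz (1, 2)%N isT.
have n13 : (a 1 3 == 0) = false := nz (1, 3)%N isT.
have n17 : (a 1 7 == 0) = false := nz (1, 7)%N isT.
pose n1 := (oner_eq0 F, n12, n13, n17).
exists [:: 1; 1; 1; 1; (a 1 7)^-1; (a 1 2)^-1; (a 1 3)^-1; 1].
  by rewrite /= !(mulf_eq0, invr_eq0, n1).
by rewrite /=; do !split => //; field; rewrite ?n1.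
Qed.

Lemma rescale_T11 a : nonzero_on a (T 11) ->
  rescalable a (T 11) (nseq 3 1).
Proof.
move=> nz.
have n12 : (a 1 2 == 0) = false := nz (1, 2)%N isT.
have n16 : (a 1 6 == 0) = false := nz (1, 6)%N isT.
have n26 : (a 2 6 == 0) = false := nz (2, 6)%N isT.
pose n1 := (oner_eq0 F, n12, n16, n26).
exists [:: 1; 1; 1; (a 1 6)^-1; (a 2 6)^-1; (a 1 2)^-1; 1; 1].
  by rewrite /= !(mulf_eq0, invr_eq0, n1).
by rewrite /=; do !split => //; field; rewrite ?n1.
Qed.

Lemma rescale_T12 a : nonzero_on a (T 12) ->
  rescalable a (T 12) (nseq 3 1).
Proof.
move=> nz.
have n12 : (a 1 2 == 0) = false := nz (1, 2)%N isT.
have n16 : (a 1 6 == 0) = false := nz (1, 6)%N isT.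
have n67 : (a 6 7 == 0) = false := nz (6, 7)%N isT.
pose n1 := (oner_eq0 F, n12, n16, n67).
exists [:: 1; 1; 1; (a 1 6)^-1; 1; (a 1 2)^-1; 1; a 6 7 / a 1 2].
  by rewrite /= !(mulf_eq0, invr_eq0, n1).
by rewrite /=; do !split => //; field; rewrite ?n1.
Qed.

Lemma rescale_T13 a : nonzero_on a (T 13) ->
  rescalable a (T 13) (nseq 4 1).
Proof.
move=> nz.
have n12 : (a 1 2 == 0) = false := nz (1, 2)%N isT.
have n13 : (a 1 3 == 0) = false := nz (1, 3)%N isT.
have n14 : (a 1 4 == 0) = false := nz (1, 4)%N isT.
have n15 : (a 1 5 == 0) = false := nz (1, 5)%N isT.
pose n0 := (n12, n13, n14, n15).
have [s s2 ns] := @square_root (a 1 2 * a 1 5)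
  ltac:(by rewrite !(mulf_eq0, invr_eq0, n0)).
pose n1 := (oner_eq0 F, n0, ns).
exists [:: 1; s; 1; 1; 1; s / a 1 2; s / a 1 3; s / a 1 4].
  by rewrite /= !(mulf_eq0, invr_eq0, n1).
by rewrite /=; do !split => //; field: s2; rewrite ?n1.
Qed.

Lemma rescale_T15 a : nonzero_on a (T 15) ->
  rescalable a (T 15) (nseq 4 1).
Proof.
move=> nz.
have n12 : (a 1 2 == 0) = false := nz (1, 2)%N isT.
have n16 : (a 1 6 == 0) = false := nz (1, 6)%N isT.
have n17 : (a 1 7 == 0) = false := nz (1, 7)%N isT.
have n26 : (a 2 6 == 0) = false := nz (2, 6)%N isT.
pose n1 := (oner_eq0 F, n12, n16, n17, n26).
exists [:: 1; 1; a 2 6; (a 1 6)^-1; 1; a 2 6 / a 1 2; 1; a 1 7].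
  by rewrite /= !(mulf_eq0, invr_eq0, n1).
by rewrite /=; do !split => //; field; rewrite ?n1.
Qed.

(** Here 12, 67 have third point 5 and 16, 27 have third point 3. Dividing the product of the
    conditions for 12, 16 by that for 67, 27 leaves the square of b_1 / b_7, which is prescribed by
    [s]. *)
Lemma rescale_T16 a : nonzero_on a (T 16) ->
  rescalable a (T 16) (nseq 4 1).
Proof.
move=> nz.
have n12 : (a 1 2 == 0) = false := nz (1, 2)%N isT.
have n16 : (a 1 6 == 0) = false := nz (1, 6)%N isT.
have n27 : (a 2 7 == 0) = false := nz (2, 7)%N isT.
have n67 : (a 6 7 == 0) = false := nz (6, 7)%N isT.
pose n0 := (n12, n16, n27, n67).
have [s s2 ns] := @square_root (a 1 2 * a 1 6 / (a 6 7 * a 2 7))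
  ltac:(by rewrite !(mulf_eq0, invr_eq0, n0)).
pose n1 := (oner_eq0 F, n0, ns).
exists [:: 1; s; 1; (a 2 7)^-1; 1; s / a 1 2; a 6 7 * s / a 1 2; 1].
  by rewrite /= !(mulf_eq0, invr_eq0, n1).
(* Eliminating a_16 in favour of s^2 turns all the conditions into rational identities. *)
have E16 : a 1 6 = s ^+ 2 * (a 6 7 * a 2 7) / a 1 2 by rewrite s2; field; rewrite ?n1.
by rewrite /= ?E16; do !split => //; field; rewrite ?n1.
Qed.

(** The edges 16, 27 have third point 3 and 17, 26 have third point 4, so the conditions prescribe
    the square of b_1 / b_2. *)
Lemma rescale_T18 a : nonzero_on a (T 18) ->
  rescalable a (T 18) (nseq 5 1).
Proof.
move=> nz.
have n12 : (a 1 2 == 0) = false := nz (1, 2)%N isT.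
have n16 : (a 1 6 == 0) = false := nz (1, 6)%N isT.
have n17 : (a 1 7 == 0) = false := nz (1, 7)%N isT.
have n26 : (a 2 6 == 0) = false := nz (2, 6)%N isT.
have n27 : (a 2 7 == 0) = false := nz (2, 7)%N isT.
pose n0 := (n12, n16, n17, n26, n27).
have [s s2 ns] := @square_root (a 1 6 * a 1 7 / (a 2 6 * a 2 7))
  ltac:(by rewrite !(mulf_eq0, invr_eq0, n0)).
pose n1 := (oner_eq0 F, n0, ns).
exists [:: 1; s; 1; s / a 1 6; (a 2 6)^-1; s / a 1 2; 1; a 2 7 * s / a 1 6].
  by rewrite /= !(mulf_eq0, invr_eq0, n1).
have E16 : a 1 6 = s ^+ 2 * (a 2 6 * a 2 7) / a 1 7 by rewrite s2; field; rewrite ?n1.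
by rewrite /= ?E16; do !split => //; field; rewrite ?n1.
Qed.

(** The support is the complete quadrangle on 3, 4, 6, 7, off the line {1, 2, 5}. Opposite edges
    share their third point, which prescribes the squares of b_4 / b_3 and b_6 / b_3; [p] and [q]
    are these ratios, with b_3 = 1. *)
Lemma rescale_T19 a : nonzero_on a (T 19) ->
  rescalable a (T 19) (nseq 6 1).
Proof.
move=> nz.
have n34 : (a 3 4 == 0) = false := nz (3, 4)%N isT.
have n36 : (a 3 6 == 0) = false := nz (3, 6)%N isT.
have n37 : (a 3 7 == 0) = false := nz (3, 7)%N isT.
have n46 : (a 4 6 == 0) = false := nz (4, 6)%N isT.
have n47 : (a 4 7 == 0) = false := nz (4, 7)%N isT.
have n67 : (a 6 7 == 0) = false := nz (6, 7)%N isT.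
pose n0 := (n34, n36, n37, n46, n47, n67).
have [p p2 np] := @square_root (a 4 7 / a 3 6 * (a 4 6 / a 3 7))
  ltac:(by rewrite !(mulf_eq0, invr_eq0, n0)).
have [q q2 nq] := @square_root (a 6 7 / a 3 4 * (a 4 6 / a 3 7))
  ltac:(by rewrite !(mulf_eq0, invr_eq0, n0)).
pose n1 := (oner_eq0 F, n0, np, nq).
exists [:: 1; q / a 3 6; a 4 7 / a 3 6 * q / (p * a 3 7); 1; p; p / a 3 4; q;
  a 4 7 / a 3 6 * q / p].
  by rewrite /= !(mulf_eq0, invr_eq0, n1).
have E47 : a 4 7 = p ^+ 2 * (a 3 6 * a 3 7) / a 4 6 by rewrite p2; field; rewrite ?n1.
have E67 : a 6 7 = q ^+ 2 * (a 3 4 * a 3 7) / a 4 6 by rewrite q2; field; rewrite ?n1.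
by rewrite /= ?E47 ?E67; do !split => //; field; rewrite ?n1.
Qed.

(** Two full lines through 1 prescribe two values for b_1^2, and one scale cannot meet both. The
    parameter is their ratio. *)
Lemma rescale_T14 a : nonzero_on a (T 14) ->
  rescalable a (T 14) [:: 1; 1; 1; a 1 3 * a 1 6 / (a 1 2 * a 1 5)].
Proof.
move=> nz.
have n12 : (a 1 2 == 0) = false := nz (1, 2)%N isT.
have n13 : (a 1 3 == 0) = false := nz (1, 3)%N isT.
have n15 : (a 1 5 == 0) = false := nz (1, 5)%N isT.
have n16 : (a 1 6 == 0) = false := nz (1, 6)%N isT.
pose n0 := (n12, n13, n15, n16).
have [s s2 ns] := @square_root (a 1 2 * a 1 5)
  ltac:(by rewrite !(mulf_eq0, invr_eq0, n0)).
pose n1 := (oner_eq0 F, n0, ns).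
exists [:: 1; s; 1; 1; 1; s / a 1 2; s / a 1 3; 1].
  by rewrite /= !(mulf_eq0, invr_eq0, n1).
by rewrite /=; do !split => //; field: s2; rewrite ?n1.
Qed.

(** The obstruction is the same as on T_14, but the normal form spreads it evenly over 13 and 16.
    Only l^2 is prescribed, whence the signs in the equivalences. *)
Lemma rescale_T17 a l : nonzero_on a (T 17) -> (l == 0) = false ->
  l ^+ 2 = a 1 3 * a 1 6 / (a 1 2 * a 1 5) ->
  rescalable a (T 17) [:: 1; l; 1; 1; l].
Proof.
move=> nz nl l2.
have n12 : (a 1 2 == 0) = false := nz (1, 2)%N isT.
have n13 : (a 1 3 == 0) = false := nz (1, 3)%N isT.
have n14 : (a 1 4 == 0) = false := nz (1, 4)%N isT.
have n15 : (a 1 5 == 0) = false := nz (1, 5)%N isT.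
have n16 : (a 1 6 == 0) = false := nz (1, 6)%N isT.
pose n0 := (n12, n13, n14, n15, n16).
have [s s2 ns] := @square_root (a 1 2 * a 1 5)
  ltac:(by rewrite !(mulf_eq0, invr_eq0, n0)).
pose n1 := (oner_eq0 F, n0, ns, nl).
exists [:: 1; s; 1; 1; 1; s / a 1 2; l * s / a 1 3; s / a 1 4].
  by rewrite /= !(mulf_eq0, invr_eq0, n1).
have E16 : a 1 6 = l ^+ 2 * (a 1 2 * a 1 5) / a 1 3 by rewrite l2; field; rewrite ?n1.
by rewrite /= ?E16; do !split => //; field: s2; rewrite ?n1.
Qed.

Lemma rescale_T20 a l m : nonzero_on a (T 20) -> (l == 0) = false -> (m == 0) = false ->
  l ^+ 2 = a 1 3 * a 1 6 / (a 1 2 * a 1 5) ->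
  m ^+ 2 = a 1 4 * a 1 7 / (a 1 2 * a 1 5) ->
  rescalable a (T 20) [:: 1; l; m; 1; l; m].
Proof.
move=> nz nl nm l2 m2.
have n12 : (a 1 2 == 0) = false := nz (1, 2)%N isT.
have n13 : (a 1 3 == 0) = false := nz (1, 3)%N isT.
have n14 : (a 1 4 == 0) = false := nz (1, 4)%N isT.
have n15 : (a 1 5 == 0) = false := nz (1, 5)%N isT.
have n16 : (a 1 6 == 0) = false := nz (1, 6)%N isT.
have n17 : (a 1 7 == 0) = false := nz (1, 7)%N isT.
pose n0 := (n12, n13, n14, n15, n16, n17).
have [s s2 ns] := @square_root (a 1 2 * a 1 5)
  ltac:(by rewrite !(mulf_eq0, invr_eq0, n0)).
pose n1 := (oner_eq0 F, n0, ns, nl, nm).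
exists [:: 1; s; 1; 1; 1; s / a 1 2; l * s / a 1 3; m * s / a 1 4].
  by rewrite /= !(mulf_eq0, invr_eq0, n1).
have E16 : a 1 6 = l ^+ 2 * (a 1 2 * a 1 5) / a 1 3 by rewrite l2; field; rewrite ?n1.
have E17 : a 1 7 = m ^+ 2 * (a 1 2 * a 1 5) / a 1 4 by rewrite m2; field; rewrite ?n1.
by rewrite /= ?E16 ?E17; do !split => //; field: s2; rewrite ?n1.
Qed.

Definition rescaled a b i j : F := a i j * b (fano_sum i j) / (b i * b j).

Lemma label_tripleP i j k : label_triple i j k ->
  [&& i < 8, j < 8, k < 8, fano_sum j k < 8 & fano_sum k i < 8]%N &&
  (fano_sum i (fano_sum j k) == fano_sum j (fano_sum k i)).
Proof.
move=> /andP[/and3P[i8 j8 k8] _]; rewrite i8 j8 k8 !fano_sum_lt //=.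
move: i j k i8 j8 k8; apply: (@forall8_3 (fun i j k =>
  fano_sum i (fano_sum j k) == fano_sum j (fano_sum k i))); by vm_compute.
Qed.

(** Both sides of a Jacobi relation acquire the same factor, the scale at the sum of the three
    labels divided by the product of their scales. *)
Lemma jacobi_rescaled a b : (forall i, b i != 0) -> jacobi_labels a ->
  jacobi_labels (rescaled a b).
Proof.
move=> b0 J i j k ijk; have := J i j k ijk.
have /andP[/and5P[i8 j8 k8 jk8 ki8] /eqP Eijk] := label_tripleP ijk.
have symE m n : (m < 8)%N -> (n < 8)%N -> sym_value (rescaled a b) m n
    = sym_value a m n * b (fano_sum m n) / (b m * b n).
  move=> m8 n8; rewrite /sym_value /rescaled; case: (Nat.ltb n m) => //.
  have /eqP-> : fano_sum n m == fano_sum m n.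
    by apply: (@forall8_2 (fun m n => fano_sum n m == fano_sum m n)); [vm_compute | |].
  by rewrite [b n * _]mulrC.
rewrite !symE // Eijk; move: (sym_value a _ _) (sym_value a _ _) => u v.
move: (sym_value a _ _) (sym_value a _ _) => w z uv.
set x := b (fano_sum j (fano_sum k i)).
transitivity (v * u * x / (b i * b j * b k)).
  by field; rewrite !b0.
by rewrite uv; field; rewrite !b0.
Qed.

Lemma rescalable_nseq a E s : all (fun x => x != 0) s ->
  (forall e, e \in E -> rescaled a (nth 1 s) e.1 e.2 = 1) ->
  rescalable a E (nseq (size E) 1).
Proof.
move=> s0 H; exists s => //; elim: E H => //= e E IHE H; split; last first.
  by apply: IHE => e' e'E; apply: H; rewrite inE e'E orbT.
have := H e (mem_head _ _); rewrite /rescaled => /divr1_eq ->.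
by rewrite mul1r.
Qed.

Lemma rescale_T21 a : jacobi_labels a -> nonzero_on a (T 21) ->
  rescalable a (T 21) (nseq 6 1).
Proof.
move=> J nz.
have n12 : (a 1 2 == 0) = false := nz (1, 2)%N isT.
have n13 : (a 1 3 == 0) = false := nz (1, 3)%N isT.
have n17 : (a 1 7 == 0) = false := nz (1, 7)%N isT.
have n23 : (a 2 3 == 0) = false := nz (2, 3)%N isT.
pose s := [:: 1; 1; 1; 1; (a 1 7 * a 2 3)^-1; (a 1 2)^-1; (a 1 3)^-1; (a 2 3)^-1].
have s0 : all (fun x => x != 0) s.
  by rewrite /= !(mulf_eq0, invr_eq0, oner_eq0, n12, n13, n17, n23).
apply: (rescalable_nseq (E := T 21) s0).
apply: propagate_T21; first by apply: jacobi_rescaled J => i; apply: nth_neq0.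
all: by rewrite /rescaled /=; field; rewrite ?(n12, n13, n17, n23).
Qed.

(* The scaling that makes the values 1 on a spanning set of edges; [t] and [r]
   are only constrained when 24, resp. 34, belongs to the support. *)
Definition base_scaling a (s t r : F) : seq F :=
  let b2 := s * t * a 2 3 / a 1 4 in
  [:: 1; s; b2; r; t * r; s * b2 / a 1 2; s * r / a 1 3; s * t * r / a 1 4].

(** With s = b_1, r = b_3 and t = b_4 / b_3 free, the edges 12, 13, 14, 23 determine b_5, b_6, b_7,
    b_2. The edges 15, 24, 34 then become quadratic conditions on s, t, r respectively. *)
Lemma rescale_base a s t r : (a 1 2 == 0) = false -> (a 1 3 == 0) = false ->
  (a 1 4 == 0) = false -> (a 2 3 == 0) = false ->
  (s == 0) = false -> (t == 0) = false -> (r == 0) = false ->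
  let b := nth 1 (base_scaling a s t r) in
  [/\ forall i, b i != 0, rescaled a b 1 2 = 1, rescaled a b 1 3 = 1,
      rescaled a b 1 4 = 1 & rescaled a b 2 3 = 1] /\
  [/\ s ^+ 2 = a 1 2 * a 1 5 -> rescaled a b 1 5 = 1,
      t ^+ 2 = a 1 4 * a 2 4 / (a 1 3 * a 2 3) -> rescaled a b 2 4 = 1 &
      s ^+ 2 = a 1 2 * a 1 5 -> r ^+ 2 = a 3 4 * a 1 5 * a 2 3 / a 1 4 ->
      (a 1 5 == 0) = false -> rescaled a b 3 4 = 1].
Proof.
move=> n12 n13 n14 n23 ns nt nr b; pose nz := (n12, n13, n14, n23, ns, nt, nr).
have s0 : all (fun x => x != 0) (base_scaling a s t r).
  by rewrite /= !(mulf_eq0, invr_eq0, oner_eq0, nz).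
split; split; rewrite /rescaled /b /=.
- by move=> i; apply: nth_neq0.
- by field; rewrite ?nz.
- by field; rewrite ?nz.
- by field; rewrite ?nz.
- by field; rewrite ?nz.
- move=> s2; have -> : a 1 5 = s ^+ 2 / a 1 2 by rewrite s2; field; rewrite ?nz.
  by field; rewrite ?nz.
- move=> t2; have -> : a 2 4 = t ^+ 2 * (a 1 3 * a 2 3) / a 1 4.
    by rewrite t2; field; rewrite ?nz.
  by field; rewrite ?nz.
move=> s2 r2 n15; have -> : a 3 4 = r ^+ 2 * a 1 4 / (a 1 5 * a 2 3).
  by rewrite r2; field; rewrite ?(nz, n15).
have E15 : a 1 5 = s ^+ 2 / a 1 2 by rewrite s2; field; rewrite ?nz.
by rewrite E15; field; rewrite ?nz.
Qed.

Lemma rescale_T22 a : jacobi_labels a -> nonzero_on a (T 22) ->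
  rescalable a (T 22) (nseq 10 1).
Proof.
move=> J nz.
have n12 : (a 1 2 == 0) = false := nz (1, 2)%N isT.
have n13 : (a 1 3 == 0) = false := nz (1, 3)%N isT.
have n14 : (a 1 4 == 0) = false := nz (1, 4)%N isT.
have n15 : (a 1 5 == 0) = false := nz (1, 5)%N isT.
have n23 : (a 2 3 == 0) = false := nz (2, 3)%N isT.
have [s s2 ns] := @square_root (a 1 2 * a 1 5) ltac:(by rewrite mulf_eq0 n12 n15).
have n1 := oner_eq0 F.
have [[b0 e12 e13 e14 e23] [/(_ s2) e15 _ _]] := rescale_base n12 n13 n14 n23 ns n1 n1.
apply: (@rescalable_nseq a (T 22) (base_scaling a s 1 1)).
  by rewrite /= !(mulf_eq0, invr_eq0, oner_eq0, n12, n13, n14, n23, ns).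
by apply: propagate_T22 => //; apply: jacobi_rescaled.
Qed.

Lemma rescale_T23 a : jacobi_labels a -> nonzero_on a (T 23) ->
  rescalable a (T 23) (nseq 15 1).
Proof.
move=> J nz.
have n12 : (a 1 2 == 0) = false := nz (1, 2)%N isT.
have n13 : (a 1 3 == 0) = false := nz (1, 3)%N isT.
have n14 : (a 1 4 == 0) = false := nz (1, 4)%N isT.
have n15 : (a 1 5 == 0) = false := nz (1, 5)%N isT.
have n23 : (a 2 3 == 0) = false := nz (2, 3)%N isT.
have n24 : (a 2 4 == 0) = false := nz (2, 4)%N isT.
have [s s2 ns] := @square_root (a 1 2 * a 1 5) ltac:(by rewrite mulf_eq0 n12 n15).
have [t t2 nt] := @square_root (a 1 4 * a 2 4 / (a 1 3 * a 2 3))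
  ltac:(by rewrite !(mulf_eq0, invr_eq0, n13, n14, n23, n24)).
have n1 := oner_eq0 F.
have [[b0 e12 e13 e14 e23] [/(_ s2) e15 /(_ t2) e24 _]] :=
  rescale_base n12 n13 n14 n23 ns nt n1.
apply: (@rescalable_nseq a (T 23) (base_scaling a s t 1)).
  by rewrite /= !(mulf_eq0, invr_eq0, oner_eq0, n12, n13, n14, n23, ns, nt).
by apply: propagate_T23 => //; apply: jacobi_rescaled.
Qed.

Lemma rescale_T24 a : jacobi_labels a -> nonzero_on a (T 24) ->
  rescalable a (T 24) (nseq 21 1).
Proof.
move=> J nz.
have n12 : (a 1 2 == 0) = false := nz (1, 2)%N isT.
have n13 : (a 1 3 == 0) = false := nz (1, 3)%N isT.
have n14 : (a 1 4 == 0) = false := nz (1, 4)%N isT.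
have n15 : (a 1 5 == 0) = false := nz (1, 5)%N isT.
have n23 : (a 2 3 == 0) = false := nz (2, 3)%N isT.
have n24 : (a 2 4 == 0) = false := nz (2, 4)%N isT.
have n34 : (a 3 4 == 0) = false := nz (3, 4)%N isT.
have [s s2 ns] := @square_root (a 1 2 * a 1 5) ltac:(by rewrite mulf_eq0 n12 n15).
have [t t2 nt] := @square_root (a 1 4 * a 2 4 / (a 1 3 * a 2 3))
  ltac:(by rewrite !(mulf_eq0, invr_eq0, n13, n14, n23, n24)).
have [r r2 nr] := @square_root (a 3 4 * a 1 5 * a 2 3 / a 1 4)
  ltac:(by rewrite !(mulf_eq0, invr_eq0, n34, n15, n23, n14)).
have [[b0 e12 e13 e14 e23] [/(_ s2) e15 /(_ t2) e24 /(_ s2 r2 n15) e34]] :=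
  rescale_base n12 n13 n14 n23 ns nt nr.
apply: (@rescalable_nseq a (T 24) (base_scaling a s t r)).
  by rewrite /= !(mulf_eq0, invr_eq0, oner_eq0, n12, n13, n14, n23, ns, nt, nr).
by apply: propagate_T24 => //; apply: jacobi_rescaled.
Qed.

End Rescaling.

(** * Classification *)

(** The entry for index 0, where T is empty, only makes the position equal to the index. *)
Definition adjacency : seq (seq bitseq) := Eval vm_compute in
  [seq [seq [seq (minn i j, maxn i j) \in T t | j <- labels] | i <- labels]
  | t <- iota 0 25].

Definition adj (t i j : nat) : bool := nth false (nth [::] (nth [::] adjacency t) i) j.

Lemma adjE t i j : (t < 25)%N -> (i < 8)%N -> (j < 8)%N ->
  adj t i j = ((minn i j, maxn i j) \in T t).
Proof.
move=> t25 i8 j8; apply/eqP.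
have : all (fun t => all (fun i => all (fun j =>
    adj t i j == ((minn i j, maxn i j) \in T t)) (iota 0 8)) (iota 0 8)) (iota 0 25).
  by vm_compute.
by move=> /allP/(_ t); rewrite mem_iota => /(_ t25)/forall8_2; apply.
Qed.

Section EpsOf.
Variable F : fieldType.

Lemma eps_of_sym E (v : seq F) g h : eps_of E v g h = eps_of E v h g.
Proof. by rewrite /eps_of minnC maxnC. Qed.

Lemma eps_of_gd E (v : seq F) i j : (i < 8)%N -> (j < 8)%N ->
  eps_of E v (gd i) (gd j) = nth 0 v (index (minn i j, maxn i j) E).
Proof. by move=> i8 j8; rewrite /eps_of -!/(gi _) !gdK. Qed.

Lemma eps_of_neq0 E (v : seq F) g h : all (fun x => x != 0) v -> size v = size E ->
  (eps_of E v g h != 0) = ((minn (gi g) (gi h), maxn (gi g) (gi h)) \in E).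
Proof.
move=> /allP v0 sz; rewrite /eps_of -!/(gi _) -index_mem -sz.
have [lt|le] := ltnP; first by apply: v0; apply: mem_nth.
by rewrite nth_default ?eqxx.
Qed.

Lemma eps_of_adj t (v : seq F) g h : (t < 25)%N ->
  all (fun x => x != 0) v -> size v = size (T t) ->
  (eps_of (T t) v g h != 0) = adj t (gi g) (gi h).
Proof. by move=> t25 v0 sz; rewrite eps_of_neq0 // adjE ?gi_lt. Qed.

Lemma epsT_adj t g h : (t < 25)%N -> epsT F t g h = (adj t (gi g) (gi h))%:R.
Proof.
move=> t25; rewrite adjE ?gi_lt // /epsT /eps_of -!/(gi _) nth_nseq index_mem.
by case: ifP.
Qed.

Lemma indep_labels g h k : indep g h k -> nindep (gi g) (gi h) (gi k).
Proof. by rewrite -indep_gd ?gi_lt // !giK. Qed.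

(** All edges of these supports contain 1. For independent i, j, k the label 1 cannot occur both in
    {i, j*k} and in {j, k}, so every Jacobi product is 0 and the values are unconstrained. *)
Lemma jacobi_map_eps_of t (v : seq F) : t \in [:: 14; 17; 20]%N ->
  all (fun x => x != 0) v -> size v = size (T t) -> jacobi_map (eps_of (T t) v).
Proof.
move=> tt v0 sz; split=> [g h _ _ _|g h k ind]; first exact: eps_of_sym.
have t25 : (t < 25)%N by move: tt; rewrite !inE => /or3P[] /eqP->.
have H i j l : (i < 8)%N -> (j < 8)%N -> (l < 8)%N ->
    nindep i j l ==> ~~ (adj t i (fano_sum j l) && adj t j l).
  apply: (@forall8_3 (fun i j l => nindep i j l ==> ~~ (adj t i (fano_sum j l) && adj t j l))).
  by move: tt; rewrite !inE => /or3P[] /eqP->; vm_compute.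
have Z g' h' k' : indep g' h' k' ->
    eps_of (T t) v g' (h' + k') * eps_of (T t) v h' k' = 0.
  move=> /indep_labels ind'; have /implyP/(_ ind') := H _ _ _ (gi_lt g') (gi_lt h') (gi_lt k').
  rewrite -giD -!(eps_of_adj _ _ t25 v0 sz) negb_and !negbK => /orP[] /eqP->;
    by rewrite ?mul0r ?mulr0.
by rewrite !Z // (indep_rot ind).
Qed.

(** With values 0 and 1 the Jacobi relations are equalities of booleans about the support. *)
Lemma jacobi_map_epsT t : (1 <= t <= 24)%N -> t \notin [:: 8; 14; 17; 20]%N ->
  jacobi_map (epsT F t).
Proof.
move=> t24 tn; split=> [g h _ _ _|g h k /indep_labels ind]; first exact: eps_of_sym.
have t25 : (t < 25)%N by case/andP: t24.
have := isT; have : all (fun t => all (fun i => all (fun j => all (fun l => nindep i j l ==>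
   ((adj t i (fano_sum j l) && adj t j l) == (adj t j (fano_sum l i) && adj t l i)))
   labels) labels) labels) [seq t <- iota 1 24 | t \notin [:: 8; 14; 17; 20]%N].
  by vm_compute.
move=> /allP/(_ t); rewrite mem_filter tn mem_iota t24 => /(_ isT).
move=> /forall8_3/(_ _ _ _ (gi_lt g) (gi_lt h) (gi_lt k))/implyP/(_ ind)/eqP H _.
by rewrite !epsT_adj // !giD -!natrM !mulnb H.
Qed.

End EpsOf.

Section Representatives.
Variable F : numClosedFieldType.

Definition rep_index (r : rep F) : nat :=
  match r with RepT i => i | RepT14 _ => 14 | RepT17 _ => 17 | RepT20 _ _ => 20 end.

Definition rep_values (r : rep F) : seq F :=
  match r with
  | RepT i => nseq (size (T i)) 1
  | RepT14 a => [:: 1; 1; 1; a]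
  | RepT17 a => [:: 1; a; 1; 1; a]
  | RepT20 a b => [:: 1; a; b; 1; a; b]
  end.

Lemma rep_epsE r : rep_eps r = eps_of (T (rep_index r)) (rep_values r).
Proof. by case: r. Qed.

Lemma rep_valid_values r : rep_valid r ->
  [/\ (1 <= rep_index r <= 24)%N, rep_index r != 8%N, all (fun x => x != 0) (rep_values r) &
      size (rep_values r) = size (T (rep_index r))].
Proof.
case: r => [i [i24]|a a0|a a0|a b [a0 b0]] /=; rewrite ?oner_neq0 ?a0 ?b0 //.
rewrite !inE !negb_or size_nseq => /andP[i8 _]; split=> //.
by apply/allP => x /nseqP[-> _]; apply: oner_neq0.
Qed.

Lemma jacobi_map_rep r : rep_valid r -> jacobi_map (F := F) (rep_eps r).
Proof.
move=> rv; have [_ _ v0 sz] := rep_valid_values rv.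
case: r rv v0 sz => [i [] *|a *|a *|a b *]; first exact: jacobi_map_epsT.
all: exact: jacobi_map_eps_of.
Qed.

End Representatives.

Section Classification.
Variables (F : numClosedFieldType) (V : vectType F) (br : V -> V -> V).
Variable Gam : Z23 -> {vspace V}.
Hypothesis so : so_graded br Gam.

Let two : (2 : F) != 0.
Proof. by rewrite pnatr_eq0. Qed.

Notation equiv := (contraction_equiv br Gam).

Definition has_support (eps : Z23 -> Z23 -> F) (E : seq (nat * nat)) : Prop :=
  forall e, e \in edges_X -> (eps (gd e.1) (gd e.2) != 0) = (e \in E).

Lemma equiv_rescalable (eps : Z23 -> Z23 -> F) E v : jacobi_map eps -> has_support eps E ->
  size v = size E -> rescalable (fun i j => eps (gd i) (gd j)) E v ->
  equiv eps (eps_of E v).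
Proof.
move=> [epsC _] sE sz [s s0 resc].
apply: (equiv_scale so (b := fun g => nth 1 s (gi g))) => [g|g h g0 h0 gh].
  exact: nth_neq0.
wlog lt : g h g0 h0 gh / (gi g < gi h)%N => [H|].
  have [lt|lt|E1] := ltngtP (gi g) (gi h); first exact: H.
    by rewrite epsC // addrC eps_of_sym [_ * nth 1 s (gi h)]mulrC H // eq_sym.
  by rewrite -(giK g) -(giK h) E1 eqxx in gh.
have gi0 : (0 < gi g)%N.
  by rewrite lt0n; apply: contra_neq g0 => E0; rewrite -(giK g) E0.
have eX : (gi g, gi h) \in edges_X by rewrite mem_edges_X ?gi_lt // gi0.
rewrite /eps_of -!/(gi _) (minn_idPl (ltnW lt)) (maxn_idPr (ltnW lt)) giD.
have := sE _ eX; rewrite /= !giK; have [eE|neE] := boolP ((gi g, gi h) \in E).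
  by move=> _; rewrite -(rescales_nth resc eE sz) /= !giK.
move=> /negbFE/eqP->; rewrite mul0r nth_default ?mul0r //.
by rewrite sz leqNgt index_mem.
Qed.

Lemma jacobi_labels_map (eps : Z23 -> Z23 -> F) : jacobi_map eps ->
  jacobi_labels (fun i j => eps (gd i) (gd j)).
Proof.
move=> epsJ i j k /andP[/and3P[i8 j8 k8] ind].
have [[i0 j0 k0 ij jk] [ki jk0 ki0 ijk jki]] := nindepP i8 j8 k8 ind.
have symE m n : (0 < m < 8)%N -> (0 < n < 8)%N -> m != n ->
    sym_value (fun i j => eps (gd i) (gd j)) m n = eps (gd m) (gd n).
  move=> m8 n8 mn; rewrite /sym_value; case: (Nat.ltb n m) => //.
  by rewrite (jacobi_map_sym epsJ) // eq_sym.
rewrite !symE ?i0 ?j0 ?k0 ?jk0 ?ki0 ?fano_sum_lt //.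
exact: jacobi_map_nat.
Qed.

Lemma has_support_nonzero (eps : Z23 -> Z23 -> F) t : t \in T_indices ->
  has_support eps (T t) -> nonzero_on (fun i j => eps (gd i) (gd j)) (T t).
Proof.
move=> tT sE e eT; apply/negbTE; rewrite sE //.
have : all (fun t => all (fun e => e \in edges_X) (T t)) T_indices by vm_compute.
by move=> /allP/(_ t tT)/allP; apply.
Qed.

(** The transposition of 4 and 7 = 1*4 carries T_8 to T_10 but is no collineation. It is realized by
    [equiv_swap], since every edge contains 1. *)
Lemma equiv_T8_T10 : equiv (epsT F 8) (epsT F 10).
Proof.
pose sw g := if g == gd 4 then gd 7 else if g == gd 7 then gd 4 else g.
have swE g : gi (sw g) = (if gi g == 4 then 7 else if gi g == 7 then 4 else gi g)%N.
  have gE n : (n < 8)%N -> (g == gd n) = (gi g == n).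
    by move=> n8; rewrite -{1}(giK g) gd_eq ?gi_lt.
  by rewrite /sw !gE //; case: ifP => _; [|case: ifP => _]; rewrite ?gdK.
apply: (@equiv_swap _ _ _ _ so _ _ (gd 1) (gd 4) sw) => //.
- by rewrite /sw eqxx gdD.
- by move=> u; rewrite gdD // !inE negb_or /sw => /andP[/negPf-> /negPf->].
- move=> u v; rewrite !epsT_adj // !swE; congr ((nat_of_bool _)%:R).
  apply/eqP; move: (gi u) (gi v) (gi_lt u) (gi_lt v).
  by apply: (@forall8_2 (fun i j => adj 8 i j == adj 10
    (if i == 4 then 7 else if i == 7 then 4 else i)%N
    (if j == 4 then 7 else if j == 7 then 4 else j)%N)); vm_compute.
move=> u v _ _ _; rewrite epsT_adj // pnatr_eq0 eqb0 negbK => uv.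
rewrite -(giK u) -(giK v) !gd_eq ?gi_lt //; move: uv; apply/implyP.
move: (gi u) (gi v) (gi_lt u) (gi_lt v).
by apply: (@forall8_2 (fun i j => adj 8 i j ==> (i == 1) || (j == 1))%N); vm_compute.
Qed.

Lemma standard_support_equiv (eps : Z23 -> Z23 -> F) t : jacobi_map eps ->
  t \in T_indices -> has_support eps (T t) ->
  exists2 r : rep F, rep_valid r & equiv eps (rep_eps r).
Proof.
move=> epsJ tT sE; have J := jacobi_labels_map epsJ.
have nz := has_support_nonzero tT sE.
have std v : size v = size (T t) -> rescalable (fun i j => eps (gd i) (gd j)) (T t) v ->
    equiv eps (eps_of (T t) v) by apply: equiv_rescalable.
have stdT : (rescalable (fun i j => eps (gd i) (gd j)) (T t) (nseq (size (T t)) 1)) ->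
    equiv eps (epsT F t) by move=> H; apply: std; rewrite ?size_nseq.
have idx_rep i : (1 <= i <= 24)%N -> i \notin [:: 8; 14; 17; 20]%N ->
    equiv eps (epsT F i) -> exists2 r : rep F, rep_valid r & equiv eps (rep_eps r).
  by move=> *; exists (RepT F i).
pose a i j := eps (gd i) (gd j).
have root E i j : nonzero_on a E -> (1, 2)%N \in E -> (1, 5)%N \in E ->
    (1, i)%N \in E -> (1, j)%N \in E ->
    exists2 l, l ^+ 2 = a 1 i * a 1 j / (a 1 2 * a 1 5) & (l == 0) = false.
  move=> nE e12 e15 e1i e1j; apply: square_root.
  by rewrite !(mulf_eq0, invr_eq0) (nE (1, 2)%N) // (nE (1, 5)%N) // (nE (1, i)%N) // (nE (1, j)%N).
rewrite -/a in J nz std stdT.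
move: tT; rewrite /T_indices !inE; repeat case/orP; move=> /eqP Et;
  rewrite Et in nz std stdT.
- by apply: (idx_rep 1%N) => //; apply: stdT; exists [::].
- by apply: (idx_rep 2%N) => //; apply: stdT; apply: rescale_T2.
- by apply: (idx_rep 3%N) => //; apply: stdT; apply: rescale_T3.
- by apply: (idx_rep 4%N) => //; apply: stdT; apply: rescale_T4.
- by apply: (idx_rep 5%N) => //; apply: stdT; apply: rescale_T5.
- by apply: (idx_rep 6%N) => //; apply: stdT; apply: rescale_T6.
- by apply: (idx_rep 7%N) => //; apply: stdT; apply: rescale_T7.
- apply: (idx_rep 10%N) => //; apply: equiv_trans equiv_T8_T10.
  by apply: stdT; apply: rescale_T8.
- by apply: (idx_rep 9%N) => //; apply: stdT; apply: rescale_T9.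
- by apply: (idx_rep 10%N) => //; apply: stdT; apply: rescale_T10.
- by apply: (idx_rep 11%N) => //; apply: stdT; apply: rescale_T11.
- by apply: (idx_rep 12%N) => //; apply: stdT; apply: rescale_T12.
- by apply: (idx_rep 13%N) => //; apply: stdT; apply: rescale_T13.
- exists (RepT14 (a 1 3 * a 1 6 / (a 1 2 * a 1 5))).
    by rewrite /= !(mulf_eq0, invr_eq0) !(nz (1, 3)%N, nz (1, 6)%N, nz (1, 2)%N, nz (1, 5)%N).
  by apply: std => //; apply: rescale_T14.
- by apply: (idx_rep 15%N) => //; apply: stdT; apply: rescale_T15.
- by apply: (idx_rep 16%N) => //; apply: stdT; apply: rescale_T16.
- have [l l2 l0] := root _ 3%N 6%N nz isT isT isT isT.
  exists (RepT17 l); first by rewrite /= l0.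
  by apply: std => //; apply: rescale_T17.
- by apply: (idx_rep 18%N) => //; apply: stdT; apply: rescale_T18.
- by apply: (idx_rep 19%N) => //; apply: stdT; apply: rescale_T19.
- have [l l2 l0] := root _ 3%N 6%N nz isT isT isT isT.
  have [m m2 m0] := root _ 4%N 7%N nz isT isT isT isT.
  exists (RepT20 l m); first by rewrite /= l0 m0.
  by apply: std => //; apply: rescale_T20.
- by apply: (idx_rep 21%N) => //; apply: stdT; apply: rescale_T21 J nz.
- by apply: (idx_rep 22%N) => //; apply: stdT; apply: rescale_T22 J nz.
- by apply: (idx_rep 23%N) => //; apply: stdT; apply: rescale_T23 J nz.
- by apply: (idx_rep 24%N) => //; apply: stdT; apply: rescale_T24 J nz.
Qed.

Lemma equiv_relabelled (eps : Z23 -> Z23 -> F) p : p \in collineations ->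
  jacobi_map eps -> let eps' g h := eps (act p g) (act p h) in
  jacobi_map eps' /\ equiv eps eps'.
Proof.
move=> pc [epsC epsJ] eps'; have [q [pD qD pq qp]] := act_collineation pc.
have p0 g : (act p g == 0) = (g == 0).
  have ap0 : act p 0 = 0 by have := Z23_addgg (act p 0); rewrite -pD addr0.
  by rewrite -{1}ap0 (inj_eq (can_inj pq)).
split; last by apply: (equiv_collineation so qD pD qp pq) => g h; rewrite /eps' !qp.
split=> [g h g0 h0 gh|g h k ind].
  by apply: epsC; rewrite ?p0 // (inj_eq (can_inj pq)).
rewrite /eps' !pD; apply: epsJ; move: ind.
by rewrite /indep -!pD !p0 !(inj_eq (can_inj pq)).
Qed.

Lemma classification (eps : Z23 -> Z23 -> F) : jacobi_map eps ->
  exists2 r : rep F, rep_valid r & equiv eps (rep_eps r).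
Proof.
move=> epsJ; have [p [t [pc tT sE]]] := support_standard epsJ.
have [eps'J eqv] := equiv_relabelled pc epsJ.
have [r rv eqv'] := standard_support_equiv eps'J tT sE.
by exists r => //; apply: equiv_trans eqv eqv'.
Qed.

End Classification.

(** * Equivalences between the representatives *)

(* A relabelling q is encoded by [:: q 7; ...; q 0], so that the labels are
   assigned in increasing order by the search. *)
Definition assigned (r : seq nat) (i : nat) : nat := nth 0 r (7 - i).

Fixpoint row_ok (t u m x : nat) (r : seq nat) : bool :=
  if r is y :: r' then
    if adj t m (size r') (+) adj u x y then false else row_ok t u m x r'
  else true.

Definition partial_iso (t u : nat) (r : seq nat) : bool :=
  if r is x :: r' then
    if x \in r' then false else row_ok t u (size r') x r'
  else true.

Definition line_of (i : nat) : nat := nth 0 [:: 0; 1; 2; 3; 4; 2; 3; 4] i.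

(* The three lines through 1 are numbered 2, 3, 4. *)
Definition lines_preserved (t : nat) (q : nat -> nat) : bool :=
  (q 1 == 1)%N &&
  (if t == 20 then [:: line_of (q 2); line_of (q 3); line_of (q 4)] \in
     [:: [:: 2; 3; 4]; [:: 2; 4; 3]; [:: 3; 2; 4]; [:: 3; 4; 2]; [:: 4; 2; 3]; [:: 4; 3; 2]]
   else [:: line_of (q 2); line_of (q 3)] \in [:: [:: 2; 3]; [:: 3; 2]])%N.

(** Additivity on the edges is essential: T_3 and T_4 are isomorphic as graphs, and only the sums
    distinguish them. *)
Definition iso_conclusion (t u : nat) (r : seq nat) : bool :=
  let q := assigned r in
  if all (fun e => q (fano_sum e.1 e.2) == fano_sum (q e.1) (q e.2)) (T t) then
    if t == u then lines_preserved t q else false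
  else true.

Definition support_indices : seq nat := [seq t <- iota 1 24 | t != 8].

(** Supports of different sizes are handled by counting. For t = u the search matters only on the
    three families, where the action on the lines through 1 is wanted. *)
Lemma partial_iso_search t u : t \in support_indices -> u \in support_indices ->
  size (T t) = size (T u) -> t != u \/ t \in [:: 14; 17; 20]%N ->
  search labels (partial_iso t u) (iso_conclusion t u) 7 [:: 0%N].
Proof.
move=> tS uS sz tu.
have : all (fun t => all (fun u =>
  if size (T t) == size (T u) then
    if (t != u) || (t \in [:: 14; 17; 20]%N) then
      search labels (partial_iso t u) (iso_conclusion t u) 7 [:: 0%N] else true
  else true) support_indices) support_indices by vm_compute.
move=> /allP/(_ t tS)/allP/(_ u uS); rewrite sz eqxx.
by case: ifP => // /norP; case: tu => -> //; rewrite ?orbT => [[]].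
Qed.

Section Relabelling.
Variables (t u : nat) (q : nat -> nat).
Hypotheses (tS : t \in support_indices) (uS : u \in support_indices).
Hypothesis q8 : forall i, (i < 8)%N -> (q i < 8)%N.
Hypothesis qinj : {in labels &, injective q}.
Hypothesis q0 : q 0%N = 0%N.
Hypothesis qadj : forall i j, (i < 8)%N -> (j < 8)%N -> adj t i j = adj u (q i) (q j).
Hypothesis qsum : forall e, e \in T t ->
  q (fano_sum e.1 e.2) = fano_sum (q e.1) (q e.2).

(** Each edge accounts for two ordered adjacent pairs, and q permutes the labels. *)
Lemma relabelling_size : size (T t) = size (T u).
Proof.
pose bits v (s : seq nat) := [seq adj v i j | i <- s, j <- s].
have cnt v : v \in support_indices -> count id (bits v labels) = (size (T v)).*2.
  move=> vS; apply/eqP.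
  have : all (fun v => count id (bits v labels) == (size (T v)).*2) support_indices.
    by vm_compute.
  by move=> /allP/(_ v vS).
apply: double_inj; rewrite -!cnt //.
have -> : bits t labels = bits u [seq q i | i <- labels].
  by rewrite /bits /= !qadj.
suff pq : perm_eq [seq q i | i <- labels] labels.
  by apply/permP; exact: (perm_allpairs (adj u) pq pq).
have uq : uniq [seq q i | i <- labels] by rewrite map_inj_in_uniq ?iota_uniq.
have ql : {subset [seq q i | i <- labels] <= labels}.
  by move=> _ /mapP[i il ->]; move: il; rewrite !mem_iota /=; apply: q8.
by have [_ E] := uniq_min_size uq ql (leqnn 8); apply: uniq_perm.
Qed.

Lemma relabelling_iso : t = u /\ (t \in [:: 14; 17; 20]%N -> lines_preserved t q).
Proof.
have [tu|tu] := boolP ((t != u) || (t \in [:: 14; 17; 20]%N)); last first.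
  by move: tu; rewrite negb_or negbK => /andP[/eqP-> /negPf->].
have tu' : t != u \/ t \in [:: 14; 17; 20]%N by case/orP: tu; [left | right].
pose r := [:: q 7; q 6; q 5; q 4; q 3; q 2; q 1; q 0%N].
have qeq i j : (i < 8)%N -> (j < 8)%N -> (q i == q j) = (i == j).
  by move=> i8 j8; apply/eqP/eqP => [/qinj->|->] //; rewrite mem_iota.
have r7 : [:: 0%N] = drop 7 r by rewrite /= q0.
have := partial_iso_search tS uS relabelling_size tu'; rewrite r7 => /searchP rP.
have : iso_conclusion t u r.
  apply: rP => [//||].
    by apply/allP; rewrite /= !mem_iota /= !q8.
  do 8![case; first by rewrite /= ?inE ?qeq //= -?qadj // ?addbb].
  by [].
have asg i : (i < 8)%N -> assigned r i = q i by do 8![case: i => [//|i]].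
rewrite /iso_conclusion ifT; last first.
  apply/allP => e eT.
  have : all (fun t => all (fun e => [&& e.1 < 8 & e.2 < 8]%N) (T t)) support_indices.
    by vm_compute.
  move=> /allP/(_ t tS)/allP/(_ e eT)/andP[e1 e2].
  by rewrite !asg ?fano_sum_lt // qsum.
by case: eqP => // -> ?.
Qed.
End Relabelling.

(** * Invariants of the families T_14, T_17 and T_20 *)

Section Invariants.
Variables (F : numClosedFieldType) (V : vectType F) (br : V -> V -> V).
Variable Gam : Z23 -> {vspace V}.
Hypothesis so : so_graded br Gam.

Notation equiv := (contraction_equiv br Gam).

(** A rescaling by b divides these products by b_1^2, whatever the line through 1. So it preserves
    their ratios. *)
Definition line_value (r : rep F) (i : nat) : F :=
  rep_eps r (gd 1) (gd i) * rep_eps r (gd 1) (gd (fano_sum 1 i)).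

Lemma equiv_rep_lines (r r' : rep F) : rep_valid r -> rep_valid r' ->
  equiv (rep_eps r) (rep_eps r') -> rep_index r = rep_index r' /\
  (rep_index r \in [:: 14; 17; 20]%N -> exists q : nat -> nat,
    [/\ forall i, (i < 8)%N -> (q i < 8)%N, lines_preserved (rep_index r) q &
      forall i j, label_triple 1 i j -> line_value r i != 0 -> line_value r j != 0 ->
        line_value r i * line_value r' (q j) = line_value r j * line_value r' (q i)]).
Proof.
move=> rv rv' /(equivE so)[f [s [finj sinj s0 fG fbr]]].
have [t24 t8 v0 sz] := rep_valid_values rv; have [u24 u8 w0 sz'] := rep_valid_values rv'.
set t := rep_index r in t24 t8 sz *; set u := rep_index r' in u24 u8 sz' *.
have tS : t \in support_indices by rewrite mem_filter t8 mem_iota.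
have uS : u \in support_indices by rewrite mem_filter u8 mem_iota.
have adjr g h : (rep_eps r g h != 0) = adj t (gi g) (gi h).
  by rewrite rep_epsE eps_of_adj //; case/andP: t24.
have adjr' g h : (rep_eps r' g h != 0) = adj u (gi g) (gi h).
  by rewrite rep_epsE eps_of_adj //; case/andP: u24.
have [q qE] : exists q, forall i, q i = gi (s (gd i)) by exists (fun i => gi (s (gd i))).
have q8 i : (i < 8)%N -> (q i < 8)%N by move=> _; rewrite qE gi_lt.
have gq i : s (gd i) = gd (q i) by rewrite qE giK.
have q0 : q 0%N = 0%N by rewrite qE s0.
have qinj : {in labels &, injective q}.
  move=> i j; rewrite !mem_iota /= => i8 j8.
  by rewrite !qE => /(can_inj giK)/sinj/(congr1 gi); rewrite !gdK.
have adj0 v i j : v \in support_indices -> (i < 8)%N -> (j < 8)%N ->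
    (i == 0) || (j == 0) || (i == j)%N -> adj v i j = false.
  move=> vS i8 j8; have : all (fun v => all (fun i => all (fun j =>
    ((i == 0) || (j == 0) || (i == j))%N ==> ~~ adj v i j) labels) labels) support_indices.
    by vm_compute.
  by move=> /allP/(_ v vS)/forall8_2/(_ i j i8 j8)/implyP H /H/negbTE.
have supp i j : (0 < i < 8)%N -> (0 < j < 8)%N -> i != j ->
    (rep_eps r' (s (gd i)) (s (gd j)) != 0) = (rep_eps r (gd i) (gd j) != 0).
  move=> i8 j8 ij; apply: (equiv_support so finj sinj s0 fG fbr); rewrite ?gd_neq0 //.
  by rewrite gd_eq //; [case/andP: i8 | case/andP: j8].
have qadj i j : (i < 8)%N -> (j < 8)%N -> adj t i j = adj u (q i) (q j).
  move=> i8 j8; have [deg|] := boolP ((i == 0) || (j == 0) || (i == j))%N.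
    rewrite !adj0 ?q8 //; case/orP: deg => [/orP[]|] /eqP->; by rewrite ?q0 ?eqxx ?orbT.
  rewrite !negb_or -!lt0n => /andP[/andP[i0 j0] ij].
  have := supp i j; rewrite i0 i8 j0 j8 adjr adjr' !gdK // -!qE => <- //.
have qsum i j : (0 < i < 8)%N -> (0 < j < 8)%N -> i != j -> adj t i j ->
    s (gd i + gd j) = s (gd i) + s (gd j).
  move=> i8 j8 ij a; have [i8' j8'] : (i < 8)%N /\ (j < 8)%N by case/andP: i8; case/andP: j8.
  apply: (equiv_add so finj fG fbr); rewrite ?gd_neq0 ?gd_eq //.
  by rewrite adjr !gdK.
have qsumT e : e \in T t -> q (fano_sum e.1 e.2) = fano_sum (q e.1) (q e.2).
  move=> eT; have : all (fun t => all (fun e => [&& 0 < e.1 < 8, 0 < e.2 < 8,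
     e.1 != e.2 & adj t e.1 e.2]%N) (T t)) support_indices by vm_compute.
  move=> /allP/(_ t tS)/allP/(_ e eT)/and4P[e1 e2 e12 ae].
  have [e1' e2'] : (e.1 < 8)%N /\ (e.2 < 8)%N by case/andP: e1; case/andP: e2.
  by rewrite !qE -(gdD e1' e2') (qsum _ _ e1 e2 e12 ae) giD.
have [tu lines] := relabelling_iso tS uS q8 qinj q0 qadj qsumT.
split=> // t3; exists q; split=> [//||i j ij nzi nzj]; first exact: lines.
have /andP[/eqP q1 _] := lines t3.
have /andP[/and3P[_ i8 j8] ind] := ij.
have := equiv_ratio so finj sinj s0 fG fbr (g := gd 1) (h := gd i) (k := gd j).
rewrite indep_gd // !gdD // -/(line_value r i) -/(line_value r j) => /(_ ind nzi nzj).
by rewrite !gq q1 !gdD ?q8.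
Qed.

Lemma line_value_RepT14 (a : F) i : (i < 8)%N -> (1 < line_of i)%N ->
  line_value (RepT14 a) i = nth 0 [:: 1; a] (line_of i - 2).
Proof.
move=> i8; rewrite /line_value /rep_eps !eps_of_gd ?fano_sum_lt //.
case: i i8 => [|[|[|[|[|[|[|[|i]]]]]]]] // _ _;
  by [exact: mulr1 | exact: mul1r | exact: mulr0 | exact: mul0r | exact: erefl].
Qed.

Lemma line_value_RepT17 (a : F) i : (i < 8)%N -> (1 < line_of i)%N ->
  line_value (RepT17 a) i = nth 0 [:: 1; a ^+ 2] (line_of i - 2).
Proof.
move=> i8; rewrite /line_value /rep_eps !eps_of_gd ?fano_sum_lt //.
case: i i8 => [|[|[|[|[|[|[|[|i]]]]]]]] // _ _;
  by [exact: mulr1 | exact: mul1r | exact: mulr0 | exact: mul0r | exact: erefl].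
Qed.

Lemma line_value_RepT20 (a b : F) i : (i < 8)%N -> (1 < line_of i)%N ->
  line_value (RepT20 a b) i = nth 0 [:: 1; a ^+ 2; b ^+ 2] (line_of i - 2).
Proof.
move=> i8; rewrite /line_value /rep_eps !eps_of_gd ?fano_sum_lt //.
case: i i8 => [|[|[|[|[|[|[|[|i]]]]]]]] // _ _;
  by [exact: mulr1 | exact: mul1r | exact: mulr0 | exact: mul0r | exact: erefl].
Qed.

Definition pm (x y : F) : seq F := [:: x; - x; y; - y].

Lemma mem_pm x y z : (z \in pm x y) = (z ^+ 2 == x ^+ 2) || (z ^+ 2 == y ^+ 2).
Proof. by rewrite !inE !eqf_sqr orbA. Qed.

(** Passing to squares removes the signs. The memberships of all of x, y, u, v are used, because
    either set may collapse to a single pair of opposite elements. *)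
Lemma pm_eqi x y u v : pm x y =i pm u v <->
  (x ^+ 2 = u ^+ 2 /\ y ^+ 2 = v ^+ 2) \/ (x ^+ 2 = v ^+ 2 /\ y ^+ 2 = u ^+ 2).
Proof.
split=> [H|[] [E1 E2] z]; last 2 first.
- by rewrite !mem_pm E1 E2.
- by rewrite !mem_pm E1 E2 orbC.
have := H x; have := H y; have := H u; have := H v; rewrite !mem_pm !eqxx !orbT /=.
move=> /orP[] /eqP Ev /orP[] /eqP Eu /esym/orP[] /eqP Ey /esym/orP[] /eqP Ex;
  by [left; split; congruence | right; split; congruence].
Qed.

Section Ratios.
Variables (f f' : nat -> F) (q : nat -> nat).
Hypothesis q8 : forall i, (i < 8)%N -> (q i < 8)%N.
Hypothesis ff' : forall i j, label_triple 1 i j -> f i != 0 -> f j != 0 ->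
  f i * f' (q j) = f j * f' (q i).

Lemma two_lines_ratio c c' : lines_preserved 14 q -> c != 0 ->
  (forall i, (i < 8)%N -> (1 < line_of i)%N -> f i = nth 0 [:: 1; c] (line_of i - 2)) ->
  (forall i, (i < 8)%N -> (1 < line_of i)%N -> f' i = nth 0 [:: 1; c'] (line_of i - 2)) ->
  c' = c \/ c' = c^-1.
Proof.
move=> /andP[_ ql] c0 fE f'E; have := @ff' 2 3 isT.
rewrite (fE 2%N) // (fE 3%N) // => /(_ (oner_neq0 _) c0).
move: ql; rewrite !inE => /orP[] /eqP[E2 E3];
  rewrite !f'E ?q8 ?E2 ?E3 //= !(mul1r, mulr1) => H; [left | right] => //.
by apply: (mulfI c0); rewrite mulfV.
Qed.

Lemma three_lines_ratio c d c' d' : lines_preserved 20 q -> c != 0 -> d != 0 ->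
  (forall i, (i < 8)%N -> (1 < line_of i)%N -> f i = nth 0 [:: 1; c; d] (line_of i - 2)) ->
  (forall i, (i < 8)%N -> (1 < line_of i)%N -> f' i = nth 0 [:: 1; c'; d'] (line_of i - 2)) ->
  [\/ c' = c /\ d' = d \/ c' = d /\ d' = c,
      c' = c^-1 /\ d' = d / c \/ c' = d / c /\ d' = c^-1 |
      c' = c / d /\ d' = d^-1 \/ c' = d^-1 /\ d' = c / d].
Proof.
move=> /andP[_ ql] c0 d0 fE f'E; have := @ff' 2 3 isT; have := @ff' 2 4 isT.
rewrite (fE 2%N) // (fE 3%N) // (fE 4%N) // => /(_ (oner_neq0 _) d0) + /(_ (oner_neq0 _) c0).
rewrite !mul1r; have inv (x y : F) : x != 0 -> 1 = x * y -> y = x^-1.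
  by move=> x0 E; apply: (mulfI x0); rewrite mulfV.
move: ql; rewrite !inE => ql; do 5?[case/orP: ql => ql]; move/eqP: ql => [E2 E3 E4];
  rewrite !f'E ?q8 ?E2 ?E3 ?E4 //= ?mulr1 => H4 H3.
- by apply: Or31; left.
- by apply: Or31; right.
- by apply: Or32; left; rewrite H4 (inv c c').
- by apply: Or33; right; rewrite H3 (inv d c').
- by apply: Or32; right; rewrite H4 (inv c d').
- by apply: Or33; left; rewrite H3 (inv d d').
Qed.

End Ratios.

Lemma rep_same_of_equiv (r r' : rep F) : rep_valid r -> rep_valid r' ->
  equiv (rep_eps r) (rep_eps r') -> rep_same r r'.
Proof.
move=> rv rv' eqv; have [tu lines] := equiv_rep_lines rv rv' eqv.
case: r r' rv rv' tu lines {eqv} => [i|a|a|a b] [i'|a'|a'|a' b'] //=.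
all: try by move=> [_ iT] ? E; rewrite E in iT.
all: try by move=> ? [_ iT] E; rewrite -E in iT.
- move=> a0 a0' _ /(_ isT)[q [q8 ql lv]].
  have := two_lines_ratio q8 lv ql a0 (line_value_RepT14 a) (line_value_RepT14 a').
  by rewrite !inE => -[] ->; rewrite eqxx ?orbT.
- move=> a0 a0' _ /(_ isT)[q [q8 ql lv]]; have a2 := expf_neq0 2 a0.
  have := two_lines_ratio q8 lv ql a2 (line_value_RepT17 a) (line_value_RepT17 a').
  by rewrite -/(pm a a^-1) mem_pm exprVn => -[] ->; rewrite eqxx ?orbT.
move=> [a0 b0] [a0' b0'] _ /(_ isT)[q [q8 ql lv]].
have a2 := expf_neq0 2 a0; have b2 := expf_neq0 2 b0.
have := three_lines_ratio q8 lv ql a2 b2 (line_value_RepT20 a b) (line_value_RepT20 a' b').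
by rewrite -!expr_div_n -!exprVn => -[] H; [apply: Or31 | apply: Or32 | apply: Or33];
  apply/pm_eqi.
Qed.

(** * Equivalences inside the families *)

Definition fix1 (i j : nat) : seq nat :=
  [:: 0; 1; i; j; fano_sum 1 (fano_sum i j); fano_sum 1 i; fano_sum 1 j; fano_sum i j]%N.

Lemma act_gd p i : (i < 8)%N -> act p (gd i) = gd (nth 0%N p i).
Proof. by move=> i8; rewrite /act gdK. Qed.

Definition fix1_cases : seq (nat * (nat * nat)) :=
  [seq (t, ij) | t <- [:: 14; 17], ij <- [:: (2, 3); (3, 2)]] ++
  [seq (20, ij) | ij <- [:: (2, 3); (2, 4); (3, 2); (3, 4); (4, 2); (4, 3)]].

Lemma fix1_casesP t i j : (t, (i, j)) \in fix1_cases ->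
  [/\ (i < 8)%N, (j < 8)%N, fix1 i j \in collineations &
    all (fun e => adj t (nth 0%N (fix1 i j) e.1) (nth 0%N (fix1 i j) e.2)
                  == (e \in T t)) edges_X].
Proof.
have : all (fun c => [&& c.2.1 < 8, c.2.2 < 8, fix1 c.2.1 c.2.2 \in collineations &
    all (fun e => adj c.1 (nth 0 (fix1 c.2.1 c.2.2) e.1) (nth 0 (fix1 c.2.1 c.2.2) e.2)
                  == (e \in T c.1)) edges_X]%N) fix1_cases by vm_compute.
by move=> /allP H /H/and4P[].
Qed.

(** The collineation preserves the support and permutes the line values; a rescaling then restores
    the normal form, with new parameters. *)
Lemma equiv_fix1 (r : rep F) i j v : rep_valid r ->
  (rep_index r, (i, j)) \in fix1_cases -> size v = size (T (rep_index r)) ->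
  (let eps g h := rep_eps r (act (fix1 i j) g) (act (fix1 i j) h) in
   let a k l := eps (gd k) (gd l) in
   nonzero_on a (T (rep_index r)) -> rescalable a (T (rep_index r)) v) ->
  equiv (rep_eps r) (eps_of (T (rep_index r)) v).
Proof.
move=> rv /fix1_casesP[_ _ pc /allP tE] sz resc; have [t24 _ v0 sz0] := rep_valid_values rv.
have [epsJ eqv] := equiv_relabelled so pc (jacobi_map_rep rv).
have sE : has_support (fun g h => rep_eps r (act (fix1 i j) g) (act (fix1 i j) h))
    (T (rep_index r)).
  move=> e eX.
  have [e1 e2] : (e.1 < 8)%N /\ (e.2 < 8)%N.
    by have /allP/(_ e eX)/andP[] : all (fun e => (e.1 < 8) && (e.2 < 8))%N edges_X by [].
  have /and4P[_ _ pq _] := collineationsP pc.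
  have p8 k : (k < 8)%N -> (nth 0 (fix1 i j) k < 8)%N by move=> /(forall8 pq)/andP[].
  rewrite /= !act_gd // rep_epsE eps_of_adj //; last by case/andP: t24.
  by rewrite !gdK ?p8 // (eqP (tE e eX)).
apply: equiv_trans eqv _; apply: equiv_rescalable => //.
by apply: resc; apply: has_support_nonzero sE; rewrite mem_iota.
Qed.

Lemma fix1_line (r : rep F) i j k : k \in [:: 2; 3; 4]%N -> (i < 8)%N -> (j < 8)%N ->
  let eps g h := rep_eps r (act (fix1 i j) g) (act (fix1 i j) h) in
  eps (gd 1) (gd k) * eps (gd 1) (gd (fano_sum 1 k)) = line_value r (nth 0%N (fix1 i j) k).
Proof.
move=> kl i8 j8 /=; rewrite !act_gd ?fano_sum_lt //; last 2 first.
- by move: kl; rewrite !inE => /or3P[] /eqP->.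
- by move: kl; rewrite !inE => /or3P[] /eqP->.
rewrite /line_value; congr (_ * rep_eps r (gd _) (gd _)).
move: kl; rewrite !inE => /or3P[] /eqP-> //=.
apply/eqP; move: i j i8 j8; apply: (@forall8_2 (fun i j =>
  fano_sum i j == fano_sum 1 (fano_sum 1 (fano_sum i j)))); by vm_compute.
Qed.

Lemma equiv_RepT14 (a a' : F) i j : a != 0 -> (14%N, (i, j)) \in fix1_cases ->
  a' = line_value (RepT14 a) j / line_value (RepT14 a) i ->
  equiv (rep_eps (RepT14 a)) (rep_eps (RepT14 a')).
Proof.
move=> a0 ij a'E; have [i8 j8 _ _] := fix1_casesP ij.
apply: (@equiv_fix1 (RepT14 a) i j [:: 1; 1; 1; a']) => // eps f nz.
have l3 := @fix1_line (RepT14 a) i j 3 isT i8 j8.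
have l2 := @fix1_line (RepT14 a) i j 2 isT i8 j8.
by rewrite a'E -[line_value _ j]l3 -[line_value _ i]l2; apply: (@rescale_T14 _ f).
Qed.

Lemma equiv_RepT17 (a a' : F) i j : a != 0 -> a' != 0 -> (17%N, (i, j)) \in fix1_cases ->
  a' ^+ 2 = line_value (RepT17 a) j / line_value (RepT17 a) i ->
  equiv (rep_eps (RepT17 a)) (rep_eps (RepT17 a')).
Proof.
move=> a0 a0' ij a'E; have [i8 j8 _ _] := fix1_casesP ij.
apply: (@equiv_fix1 (RepT17 a) i j [:: 1; a'; 1; 1; a']) => // eps f nz.
have l3 := @fix1_line (RepT17 a) i j 3 isT i8 j8.
have l2 := @fix1_line (RepT17 a) i j 2 isT i8 j8.
rewrite -[line_value _ j]l3 -[line_value _ i]l2 in a'E.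
by apply: (@rescale_T17 _ f) a'E => //; apply: negbTE.
Qed.

Lemma equiv_RepT20 (a b a' b' : F) i j : a != 0 -> b != 0 -> a' != 0 -> b' != 0 ->
  (20%N, (i, j)) \in fix1_cases -> let l := line_value (RepT20 a b) in
  a' ^+ 2 = l j / l i -> b' ^+ 2 = l (nth 0%N (fix1 i j) 4) / l i ->
  equiv (rep_eps (RepT20 a b)) (rep_eps (RepT20 a' b')).
Proof.
move=> a0 b0 a0' b0' ij l a'E b'E; have [i8 j8 _ _] := fix1_casesP ij.
apply: (@equiv_fix1 (RepT20 a b) i j [:: 1; a'; b'; 1; a'; b']) => // eps f nz.
have l4 := @fix1_line (RepT20 a b) i j 4 isT i8 j8.
have l3 := @fix1_line (RepT20 a b) i j 3 isT i8 j8.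
have l2 := @fix1_line (RepT20 a b) i j 2 isT i8 j8.
rewrite -[l j]l3 -[l i]l2 in a'E; rewrite -[l (nth _ _ _)]l4 -[l i]l2 in b'E.
by apply: (@rescale_T20 _ f) a'E b'E => //; apply: negbTE.
Qed.

Lemma equiv_of_rep_same (r r' : rep F) : rep_valid r -> rep_valid r' ->
  rep_same r r' -> equiv (rep_eps r) (rep_eps r').
Proof.
case: r r' => [i|a|a|a b] [i'|a'|a'|a' b'] // rv rv'; rewrite /rep_same.
- by move=> ->; apply: equiv_refl.
- rewrite !inE => /orP[] /eqP->; first exact: equiv_refl.
  apply: (@equiv_RepT14 a _ 3 2) => //.
  by rewrite !(line_value_RepT14 a) //= mul1r.
- rewrite -/(pm a a^-1) mem_pm => /orP[] /eqP E.
    apply: (@equiv_RepT17 a _ 2 3) => //.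
    by rewrite (line_value_RepT17 a (i := 3)) // (line_value_RepT17 a (i := 2)) //= divr1.
  apply: (@equiv_RepT17 a _ 3 2) => //.
  by rewrite (line_value_RepT17 a (i := 3)) // (line_value_RepT17 a (i := 2)) //= mul1r -exprVn.
case: rv rv' => a0 b0 [a0' b0'] same.
pose l := line_value (RepT20 a b).
have l2 : l 2%N = 1 := line_value_RepT20 a b (i := 2) isT isT.
have l3 : l 3%N = a ^+ 2 := line_value_RepT20 a b (i := 3) isT isT.
have l4 : l 4%N = b ^+ 2 := line_value_RepT20 a b (i := 4) isT isT.
have eqv i j : (20%N, (i, j)) \in fix1_cases ->
    a' ^+ 2 = l j / l i -> b' ^+ 2 = l (nth 0%N (fix1 i j) 4) / l i ->
    equiv (rep_eps (RepT20 a b)) (rep_eps (RepT20 a' b')).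
  exact: equiv_RepT20.
move: l l2 l3 l4 eqv => l l2 l3 l4 eqv.
have {same} := same => -[] /pm_eqi[] [Ea Eb].
- by apply: (eqv 2%N 3%N) => //=; rewrite ?l2 ?l3 ?l4 ?divr1.
- by apply: (eqv 2%N 4%N) => //=; rewrite ?l2 ?l3 ?l4 ?divr1.
- by apply: (eqv 3%N 2%N) => //=; rewrite ?l2 ?l3 ?l4 ?mul1r ?Ea ?Eb ?expr_div_n ?exprVn.
- by apply: (eqv 3%N 4%N) => //=; rewrite ?l2 ?l3 ?l4 ?mul1r ?Ea ?Eb ?expr_div_n ?exprVn.
- by apply: (eqv 4%N 3%N) => //=; rewrite ?l2 ?l3 ?l4 ?mul1r ?Ea ?Eb ?expr_div_n ?exprVn.
- by apply: (eqv 4%N 2%N) => //=; rewrite ?l2 ?l3 ?l4 ?mul1r ?Ea ?Eb ?expr_div_n ?exprVn.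
Qed.

End Invariants.

Theorem theorem3p24 (R : realType) (L : {vspace 'End(oct R[i])})
    (hL : L = b3 R[i] \/ L = d4 R[i]) :
  [/\ (* the listed maps are graded contractions of Gamma_L *)
      forall r : rep R[i], rep_valid r ->
        graded_contraction (@bracket R[i] L) (Gamma L) (rep_eps r),
      (* every graded contraction is equivalent to a listed one *)
      forall eps : Z23 -> Z23 -> R[i],
        graded_contraction (@bracket R[i] L) (Gamma L) eps ->
        exists2 r : rep R[i], rep_valid r &
          contraction_equiv (@bracket R[i] L) (Gamma L) eps (rep_eps r) &
      (* the equivalences between listed ones *)
      forall r r' : rep R[i], rep_valid r -> rep_valid r' ->
        contraction_equiv (@bracket R[i] L) (Gamma L) (rep_eps r) (rep_eps r')
        <-> rep_same r r'].
Proof.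
have two : (2 : R[i]) != 0 by rewrite pnatr_eq0.
have so := Gamma_so_graded hL two.
split=> [r rv|eps /(jacobi_mapP so two) epsJ|r r' rv rv'].
- by apply/(jacobi_mapP so two); apply: jacobi_map_rep.
- exact: (classification so epsJ).
by split; [apply: (rep_same_of_equiv so) | apply: (equiv_of_rep_same so)].
Qed.
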